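(* For a locally compact group $\mathbb{G}$ the following conditions are equivalent. (a) $\mathbb{G}$ is discrete. (b) Continuous $\mathbb{G}$-actions on topological spaces $X$ lift along Stone-Čech compactifications $X\to\beta X$ to continuous $\mathbb{G}$-actions on $\beta X$. (c) Continuous $\mathbb{G}$-actions on $C^*$-algebras $A$ lift along embeddings $A\hookrightarrow M(A)$ into multiplier algebras to continuous $\mathbb{G}$-actions on $M(A)$. (d) The forgetful functor from the category of unital $C^*$-algebras equipped with a continuous $\mathbb{G}$-action to the category of unital $C^*$-algebras preserves products. (e) The forgetful functor from the category of compact Hausdorff spaces carrying continuous $\mathbb{G}$-actions to the category of compact Hausdorff spaces preserves coproducts.
   Context: A continuous $\mathbb{G}$-action on a topological space $X$ is an action with $\mathbb{G}\times X\to X$ (jointly) continuous. A continuous $\mathbb{G}$-action on a $C^*$-algebra $A$ is an action by $*$-automorphisms such that $\mathbb{G}\ni g\mapsto ga\in A$ is norm-continuous for every $a\in A$. Morphisms in the categories of objects with $\mathbb{G}$-action are the $\mathbb{G}$-equivariant morphisms (unital $*$-homomorphisms, respectively continuous maps). $\beta$ is the Stone-Čech compactification functor, i.e. the left adjoint to the inclusion of compact Hausdorff spaces into topological spaces, and $X\to\beta X$ is the canonical map. $M(A)$ is the multiplier algebra of $A$. *)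

(* Defs.v *)
From HB Require Import structures.
From mathcomp Require Import all_boot all_order all_algebra.
From mathcomp Require Import complex.
From mathcomp Require Import all_classical all_reals topology normedtype.

Set Implicit Arguments.
Unset Strict Implicit.
Unset Printing Implicit Defensive.

Import Order.TTheory GRing.Theory Num.Theory.
Import numFieldNormedType.Exports.

Local Open Scope classical_set_scope.
Local Open Scope complex_scope.
Local Open Scope ring_scope.

HB.mixin Record isTopologicalGroup G of Group G & Topological G := {
  mulg_continuous : continuous (fun p : G * G => (p.1 * p.2)%g) ;
  invg_continuous : continuous (fun x : G => (x^-1)%g)
}.

#[short(type="topologicalGroupType")]
HB.structure Definition TopologicalGroup :=
  {G of Group G & Topological G & isTopologicalGroup G}.

(* C*-algebras need not be unital, and a unital one may be zero. *)
HB.mixin Record isCStarAlgebra (R : realType) A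
    of CompleteNormedModule R[i] A := {
  cmul : A -> A -> A ;
  cstar : A -> A ;
  cmulA : forall x y z, cmul x (cmul y z) = cmul (cmul x y) z ;
  cmulDl : forall x y z, cmul (x + y) z = cmul x z + cmul y z ;
  cmulDr : forall x y z, cmul x (y + z) = cmul x y + cmul x z ;
  cmulZl : forall (k : R[i]) x y, cmul (k *: x) y = k *: cmul x y ;
  cmulZr : forall (k : R[i]) x y, cmul x (k *: y) = k *: cmul x y ;
  cstarD : forall x y, cstar (x + y) = cstar x + cstar y ;
  cstarZ : forall (k : R[i]) x, cstar (k *: x) = k^* *: cstar x ;
  cstarM : forall x y, cstar (cmul x y) = cmul (cstar y) (cstar x) ;
  cstarK : forall x, cstar (cstar x) = x ;
  cnormM_le : forall x y, `|cmul x y| <= `|x| * `|y| ;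
  cnorm_starM : forall x, `|cmul (cstar x) x| = `|x| ^+ 2
}.

#[short(type="cstarAlgType")]
HB.structure Definition CStarAlgebra (R : realType) :=
  {A of CompleteNormedModule R[i] A & isCStarAlgebra R A}.

HB.mixin Record isUnitalCStarAlgebra (R : realType) A of CStarAlgebra R A := {
  cone : A ;
  cmul1l : forall x : A, cmul cone x = x ;
  cmul1r : forall x : A, cmul x cone = x
}.

#[short(type="unitalCStarAlgType")]
HB.structure Definition UnitalCStarAlgebra (R : realType) :=
  {A of CStarAlgebra R A & isUnitalCStarAlgebra R A}.

Record star_morphism (R : realType) (A B : cstarAlgType R) (f : A -> B) : Prop := {
  star_morphism_linear : linear f ;
  star_morphismM : forall x y, f (cmul x y) = cmul (f x) (f y) ;
  star_morphism_star : forall x, f (cstar x) = cstar (f x)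
}.

Section CStarTheory.
Variables (R : realType) (A : cstarAlgType R).
Implicit Types x y : A.

Lemma cmul0l y : cmul 0 y = 0 :> A.
Proof. by have := cmulZl 0 0 y; rewrite !scale0r. Qed.

Lemma cmul0r y : cmul y 0 = 0 :> A.
Proof. by have := cmulZr 0 y 0; rewrite !scale0r. Qed.

Lemma cstar0 : cstar 0 = 0 :> A.
Proof. by have := cstarZ 0 (0 : A); rewrite rmorph0 !scale0r. Qed.

Lemma norm_cstar_le x : `|x| <= `|cstar x|.
Proof.
have [->|x0] := eqVneq x 0; first by rewrite cstar0.
have := cnormM_le (cstar x) x; rewrite cnorm_starM expr2.
by rewrite ler_pM2r// normr_gt0.
Qed.

Lemma norm_cstar x : `|cstar x| = `|x|.
Proof.
apply/eqP; rewrite eq_le norm_cstar_le andbT.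
by have := norm_cstar_le (cstar x); rewrite cstarK.
Qed.

Lemma cnormM_star x : `|cmul x (cstar x)| = `|x| ^+ 2.
Proof. by have := cnorm_starM (cstar x); rewrite cstarK norm_cstar. Qed.

Lemma cmulBl x y z : cmul (x - y) z = cmul x z - cmul y z.
Proof. by rewrite cmulDl -scaleN1r cmulZl scaleN1r. Qed.

Lemma cmulBr x y z : cmul z (x - y) = cmul z x - cmul z y.
Proof. by rewrite cmulDr -scaleN1r cmulZr scaleN1r. Qed.

Lemma cmul_inj x y : (forall z, cmul x z = cmul y z) -> x = y.
Proof.
move=> xy; apply/eqP; rewrite -subr_eq0 -normr_eq0 -sqrf_eq0 -cnormM_star.
by rewrite cmulBl xy subrr normr0.
Qed.

End CStarTheory.

Section Multipliers.
Variables (R : realType) (A : cstarAlgType R).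

(* Pairs (L, R) of bounded linear maps on A such that L (ab) = (L a) b,
   R (ab) = a (R b) and a (L b) = (R a) b. *)
Record double_centralizer (p : (A -> A) * (A -> A)) : Prop := {
  dc_linl : linear p.1 ;
  dc_linr : linear p.2 ;
  dc_bndl : exists k : R[i], forall a, `|p.1 a| <= k * `|a| ;
  dc_bndr : exists k : R[i], forall a, `|p.2 a| <= k * `|a| ;
  dc_l : forall a b, p.1 (cmul a b) = cmul (p.1 a) b ;
  dc_r : forall a b, p.2 (cmul a b) = cmul a (p.2 b) ;
  dc_lr : forall a b, cmul a (p.1 b) = cmul (p.2 a) b
}.

Definition is_double_centralizer : {pred (A -> A) * (A -> A)} :=
  fun p => `[< double_centralizer p >].

(* M(A), realised as the C*-algebra of double centralizers of A: the product is
   (L1, R1) (L2, R2) = (L1 L2, R2 R1), the adjoint of (L, R) is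
   (a |-> cstar (R (cstar a)), a |-> cstar (L (cstar a))), and the norm is the
   operator norm of L, which equals that of R. *)
Record multiplier := Multiplier {
  mval : (A -> A) * (A -> A) ;
  _ : mval \in is_double_centralizer
}.

HB.instance Definition _ := [isSub for mval].
HB.instance Definition _ := [Choice of multiplier by <:].

Lemma multP (T : multiplier) : double_centralizer (mval T).
Proof. by apply/asboolP; exact: (valP T). Qed.


Lemma dc_bound_ge0 (f : A -> A) :
  (exists k : R[i], forall a, `|f a| <= k * `|a|) ->
  exists2 k : R[i], 0 <= k & forall a, `|f a| <= k * `|a|.
Proof.
move=> [k fk]; have [k0|k0] := boolP (0 <= k); first by exists k.
exists 0 => // a; have [->|a0] := eqVneq a 0.
  by have := fk 0; rewrite normr0 !mulr0.
have a_gt0 : 0 < `|a| by rewrite normr_gt0.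
by have := le_trans (normr_ge0 _) (fk a); rewrite pmulr_lge0// (negbTE k0).
Qed.

Lemma is_double_centralizer_submod : submod_closed is_double_centralizer.
Proof.
split=> [|k S T /asboolP[Sl Sr Sbl Sbr SL SR SLR] /asboolP[Tl Tr Tbl Tbr TL TR TLR]];
    apply/asboolP.
  split=> /=.
  - by move=> k a b; rewrite scaler0 addr0.
  - by move=> k a b; rewrite scaler0 addr0.
  - by exists 0 => a; rewrite mul0r normr0.
  - by exists 0 => a; rewrite mul0r normr0.
  - by move=> a b; rewrite cmul0l.
  - by move=> a b; rewrite cmul0r.
  - by move=> a b; rewrite cmul0l cmul0r.
have lin (f g : A -> A) : linear f -> linear g -> linear (k *: f + g).
  move=> fl gl c a b; rewrite !fctE fl gl !scalerDr !scalerA mulrC addrACA.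
  by rewrite -!addrA.
have bnd (f g : A -> A) : (exists k : R[i], forall a, `|f a| <= k * `|a|) ->
    (exists k : R[i], forall a, `|g a| <= k * `|a|) ->
    (exists c : R[i], forall a, `|(k *: f + g) a| <= c * `|a|).
  move=> [c fc] [d gd]; exists (`|k| * c + d) => a; rewrite !fctE.
  rewrite (le_trans (ler_normD _ _))// mulrDl lerD// normrZ -mulrA.
  exact: ler_wpM2l.
split=> /=.
- exact: lin.
- exact: lin.
- exact: bnd.
- exact: bnd.
- by move=> a b; rewrite !fctE SL TL cmulDl cmulZl.
- by move=> a b; rewrite !fctE SR TR cmulDr cmulZr.
- by move=> a b; rewrite !fctE cmulDl cmulZl cmulDr cmulZr SLR TLR.
Qed.

HB.instance Definition _ := GRing.isSubmodClosed.Build R[i] _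
  is_double_centralizer is_double_centralizer_submod.
HB.instance Definition _ := [SubChoice_isSubLmodule of multiplier by <:].

Definition mult_norm (T : multiplier) : R[i] :=
  (sup [set complex.Re `|(mval T).1 a| | a in [set a | `|a| <= 1]])%:C.

Lemma mult_norm_le (T : multiplier) (k : R[i]) : 0 <= k ->
  (forall a, `|(mval T).1 a| <= k * `|a|) -> mult_norm T <= k.
Proof.
move=> k0 Tk; rewrite -[k]RRe_real ?ger0_real// lecR.
apply: ge_sup; first by exists (complex.Re `|(mval T).1 0|); exists 0 => //=; rewrite normr0.
move=> _ [a /= a1 <-]; rewrite -lecR !RRe_real ?ger0_real//.
by rewrite (le_trans (Tk a))// ler_piMr.
Qed.


Lemma multZ (T : multiplier) k b : (mval T).1 (k *: b) = k *: (mval T).1 b.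
Proof.
have [Tl _ _ _ _ _ _] := multP T.
have T0 : (mval T).1 0 = 0 by have := Tl (-1) 0 0; rewrite scaler0 addr0 scaleN1r addNr.
by have := Tl k b 0; rewrite T0 !addr0.
Qed.

Lemma mult_norm_unit (T : multiplier) a :
  `|a| <= 1 -> `|(mval T).1 a| <= mult_norm T.
Proof.
move=> a1; have [_ _ Tb _ _ _ _] := multP T.
have [k k0 Tk] := dc_bound_ge0 Tb.
rewrite -[X in X <= _]RRe_real ?ger0_real// lecR; apply: ub_le_sup.
  exists (complex.Re k) => _ [b /= b1 <-]; rewrite -lecR !RRe_real ?ger0_real//.
  by rewrite (le_trans (Tk b))// ler_piMr.
by exists a.
Qed.

Lemma mult_norm_ge0 T : 0 <= mult_norm T.
Proof. by rewrite (le_trans (normr_ge0 _) (@mult_norm_unit T 0 _))// normr0. Qed.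

Lemma mult_norm_ub (T : multiplier) a : `|(mval T).1 a| <= mult_norm T * `|a|.
Proof.
have [->|a0] := eqVneq a 0.
  by rewrite -(scale0r (0 : A)) multZ !scale0r normr0 mulr0.
have a_gt0 : 0 < `|a| by rewrite normr_gt0.
rewrite -ler_pdivrMr// mulrC -[`|a|^-1]ger0_norm ?invr_ge0// -normrZ -multZ.
by rewrite mult_norm_unit// normrZ normfV normr_id mulVf ?normr_eq0.
Qed.

Lemma mult_eq (S T : multiplier) : (mval S).1 =1 (mval T).1 -> S = T.
Proof.
move=> ST; apply: val_inj => /=.
have [_ _ _ _ _ _ SLR] := multP S; have [_ _ _ _ _ _ TLR] := multP T.
have ST1 : (mval S).1 = (mval T).1 by exact/funext.
have ST2 : (mval S).2 = (mval T).2.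
  by apply/funext => a; apply: cmul_inj => b; rewrite -SLR -TLR ST.
by rewrite [mval S]surjective_pairing [mval T]surjective_pairing ST1 ST2.
Qed.

Lemma mult_normD S T : mult_norm (S + T) <= mult_norm S + mult_norm T.
Proof.
apply: mult_norm_le; first by rewrite addr_ge0 ?mult_norm_ge0.
move=> a; rewrite mulrDl (le_trans (ler_normD _ _))// lerD//; exact: mult_norm_ub.
Qed.

Lemma mult_normZ_le k T : mult_norm (k *: T) <= `|k| * mult_norm T.
Proof.
apply: mult_norm_le; first by rewrite mulr_ge0 ?mult_norm_ge0.
move=> a; rewrite [X in `|X|](_ : _ = k *: (mval T).1 a)//.
by rewrite normrZ -mulrA ler_wpM2l// mult_norm_ub.
Qed.

Lemma mult_normZ k T : mult_norm (k *: T) = `|k| * mult_norm T.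
Proof.
apply/eqP; rewrite eq_le mult_normZ_le/=.
have [->|k0] := eqVneq k 0; first by rewrite normr0 mul0r mult_norm_ge0.
rewrite -ler_pdivlMl ?normr_gt0// -normfV.
by have := mult_normZ_le k^-1 (k *: T); rewrite scalerA mulVf// scale1r.
Qed.

Lemma mult_norm0 T : mult_norm T = 0 -> T = 0.
Proof.
move=> T0; apply: mult_eq => a; apply/eqP.
by have := mult_norm_ub T a; rewrite T0 mul0r normr_le0.
Qed.

HB.instance Definition _ := Lmodule_isNormed.Build R[i] multiplier
  mult_normD mult_normZ mult_norm0.

Lemma mult_normE (T : multiplier) : `|T| = mult_norm T. Proof. by []. Qed.

Lemma mult_norm_ubr (T : multiplier) a : `|(mval T).2 a| <= mult_norm T * `|a|.
Proof.
have [_ _ _ _ _ _ TLR] := multP T; set b := (mval T).2 a.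
have [->|b0] := eqVneq b 0; first by rewrite normr0 mulr_ge0 ?mult_norm_ge0.
have b_gt0 : 0 < `|b| by rewrite normr_gt0.
rewrite -(ler_pM2r b_gt0) -expr2 -cnormM_star -TLR.
rewrite (le_trans (cnormM_le _ _))// [leRHS]mulrAC mulrC ler_wpM2r//.
by rewrite (le_trans (mult_norm_ub _ _))// norm_cstar.
Qed.

Lemma cstar_le_eps (x c : R[i]) : 0 <= x -> 0 <= c ->
  (forall e, 0 < e -> x <= e * c) -> x = 0.
Proof.
move=> x0 c0 xc; apply/eqP; apply: contraT => xN0.
have x_gt0 : 0 < x by rewrite lt_neqAle eq_sym xN0.
have c1 : 0 < c + 1 by rewrite ltr_wpDl.
have := xc (x / (c + 1)) (divr_gt0 x_gt0 c1).
rewrite -mulrA ler_pMr// ler_pdivlMl// mulr1 => cc.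
by move: cc; rewrite -subr_ge0 opprD addNKr oppr_ge0 ler10.
Qed.

Lemma mult_limit (f g : A -> A) :
  (forall e : R[i], 0 < e -> exists T : multiplier, forall a,
     `|f a - (mval T).1 a| <= e * `|a| /\ `|g a - (mval T).2 a| <= e * `|a|) ->
  (f, g) \in is_double_centralizer.
Proof.
move=> fgT.
have lin (ev : multiplier -> A -> A) (h : A -> A) : (forall T, linear (ev T)) ->
    (forall e : R[i], 0 < e ->
      exists T, forall a, `|h a - ev T a| <= e * `|a|) -> linear h.
  move=> evl hT k a b; apply/eqP; rewrite -subr_eq0 -normr_eq0; apply/eqP.
  apply: (@cstar_le_eps _ (`|k *: a + b| + `|k| * `|a| + `|b|)) => //.
    by rewrite !addr_ge0// mulr_ge0.
  move=> e e0; have [T hTe] := hT e e0.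
  rewrite [X in `|X|](_ : _ = (h (k *: a + b) - ev T (k *: a + b))
     - (k *: (h a - ev T a)) - (h b - ev T b)); last first.
    have tri (p q r q' r' : A) :
        p - (q + r) = p - (q' + r') - (q - q') - (r - r').
      rewrite !opprB !opprD !addrA (addrAC (p - q') (- r') q') subrK.
      by rewrite (addrAC p (- r')) subrK.
    by rewrite evl scalerBr; exact: tri.
  rewrite (le_trans (ler_normB _ _))// !mulrDr lerD//.
  rewrite (le_trans (ler_normB _ _))// lerD// normrZ mulrCA.
  by rewrite ler_wpM2l.
have bnd (ev : multiplier -> A -> A) (h : A -> A) :
    (forall T, exists k : R[i], forall a, `|ev T a| <= k * `|a|) ->
    (forall e : R[i], 0 < e ->
      exists T, forall a, `|h a - ev T a| <= e * `|a|) ->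
    exists k : R[i], forall a, `|h a| <= k * `|a|.
  move=> evb /(_ 1 ltr01)[T hT]; have [k kT] := evb T; exists (1 + k) => a.
  by rewrite -[h a](subrK (ev T a)) (le_trans (ler_normD _ _))// mulrDl lerD.
have fT (e : R[i]) : 0 < e -> exists T : multiplier, forall a,
    `|f a - (mval T).1 a| <= e * `|a|.
  by move=> /fgT[T TP]; exists T => a; have [] := TP a.
have gT (e : R[i]) : 0 < e -> exists T : multiplier, forall a,
    `|g a - (mval T).2 a| <= e * `|a|.
  by move=> /fgT[T TP]; exists T => a; have [] := TP a.
have fl : linear f by apply: lin fT => T; case: (multP T).
have gl : linear g by apply: lin gT => T; case: (multP T).
apply/asboolP; split => //=.
- by apply: bnd fT => T; case: (multP T).
- by apply: bnd gT => T; case: (multP T).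
- move=> a b; apply/eqP; rewrite -subr_eq0 -normr_eq0; apply/eqP.
  apply: (@cstar_le_eps _ (`|cmul a b| + `|a| * `|b|)); rewrite ?addr_ge0 ?mulr_ge0//.
  move=> e e0; have [T Te] := fT e e0; have [_ _ _ _ TL _ _] := multP T.
  rewrite -(subrKA ((mval T).1 (cmul a b))) [in X in _ + X]TL -cmulBl.
  rewrite (le_trans (ler_normD _ _))// mulrDr lerD// mulrA.
  by rewrite (le_trans (cnormM_le _ _))// ler_wpM2r// distrC.
- move=> a b; apply/eqP; rewrite -subr_eq0 -normr_eq0; apply/eqP.
  apply: (@cstar_le_eps _ (`|cmul a b| + `|a| * `|b|)); rewrite ?addr_ge0 ?mulr_ge0//.
  move=> e e0; have [T Te] := gT e e0; have [_ _ _ _ _ TR _] := multP T.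
  rewrite -(subrKA ((mval T).2 (cmul a b))) [in X in _ + X]TR -cmulBr.
  rewrite (le_trans (ler_normD _ _))// mulrDr lerD// mulrCA.
  by rewrite (le_trans (cnormM_le _ _))// ler_wpM2l// distrC.
- move=> a b; apply/eqP; rewrite -subr_eq0 -normr_eq0; apply/eqP.
  apply: (@cstar_le_eps _ (`|a| * `|b| + `|a| * `|b|)); rewrite ?addr_ge0 ?mulr_ge0//.
  move=> e e0; have [T Te] := fgT e e0; have [_ _ _ _ _ _ TLR] := multP T.
  rewrite -(subrKA (cmul a ((mval T).1 b))) [in X in _ + X]TLR -cmulBr -cmulBl.
  rewrite (le_trans (ler_normD _ _))// mulrDr lerD//.
    rewrite mulrCA (le_trans (cnormM_le _ _))// ler_wpM2l//.
    by have [] := Te b.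
  rewrite mulrA (le_trans (cnormM_le _ _))// ler_wpM2r// distrC.
  by have [] := Te a.
Qed.

Lemma mult_complete (F : set_system multiplier) :
  ProperFilter F -> cauchy F -> cvg F.
Proof.
move=> FF Fc.
have lim_ev (ev : multiplier -> A -> A) :
    (forall S T a, `|ev S a - ev T a| <= `|S - T| * `|a|) ->
    exists f, forall S (e : R[i]), 0 < e -> F (ball S e) ->
      forall a, `|f a - ev S a| <= e * `|a|.
  move=> evB; have evc a : cvg ((ev ^~ a) @ F).
    apply: cauchy_cvg; apply/cauchy_exP => e e0.
    have a1 : 0 < `|a| + 1 by rewrite ltr_wpDl.
    have /cauchyP/(_ (e / (`|a| + 1)) (divr_gt0 e0 a1))[S FS] := Fc.
    exists (ev S a); rewrite /fmap/=; apply: filterS FS => T /=.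
    rewrite -!ball_normE /ball_/= => ST.
    rewrite (le_lt_trans (evB _ _ _))//.
    rewrite (@le_lt_trans _ _ (e / (`|a| + 1) * `|a|))//.
      by rewrite ler_wpM2r// ltW.
    by rewrite -mulrA gtr_pMr// mulrC ltr_pdivrMr// mul1r ltrDl.
  exists (fun a => lim ((ev ^~ a) @ F)) => S e e0 FS a.
  apply/ler_addgt0Pr => d d0.
  have /cvgrPdist_le/(_ d d0) Fd := evc a.
  have [T [Td]] := filter_ex (filterI Fd FS).
  rewrite -ball_normE /ball_/= => ST.
  rewrite -(subrKA (ev T a)) addrC (le_trans (ler_normD _ _))// lerD//.
  rewrite distrC (le_trans (evB _ _ _))// ler_wpM2r// ltW//.
have [f fP] := lim_ev (fun T => (mval T).1) (fun S T a => mult_norm_ub (S - T) a).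
have [g gP] := lim_ev (fun T => (mval T).2) (fun S T a => mult_norm_ubr (S - T) a).
have fgP : (f, g) \in is_double_centralizer.
  apply: mult_limit => e e0; have /cauchyP/(_ e e0)[S FS] := Fc.
  by exists S => a; split; [exact: fP FS a|exact: gP FS a].
apply/cvg_ex; exists (Multiplier fgP); apply/fcvg_ballP => e e0.
have e20 : 0 < e / 2 by rewrite divr_gt0.
have /cauchyP/(_ _ e20)[S FS] := Fc.
apply: filterS (FS) => T; rewrite -!ball_normE /ball_/= => ST.
rewrite -(subrKA S) [e]splitr (le_lt_trans (ler_normD _ _))// ler_ltD//.
apply: mult_norm_le; first exact: ltW.
by move=> a; exact: fP FS a.
Qed.

HB.instance Definition _ := Uniform_isComplete.Build multiplier mult_complete.

Lemma mult_mul_subproof (S T : multiplier) :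
  ((mval S).1 \o (mval T).1, (mval T).2 \o (mval S).2)
    \in is_double_centralizer.
Proof.
have [Sl Sr Sbl Sbr SL SR SLR] := multP S.
have [Tl Tr Tbl Tbr TL TR TLR] := multP T.
have bnd (f g : A -> A) : (exists k : R[i], forall a, `|f a| <= k * `|a|) ->
    (exists k : R[i], forall a, `|g a| <= k * `|a|) ->
    (exists c : R[i], forall a, `|(f \o g) a| <= c * `|a|).
  move=> /dc_bound_ge0[c c0 fc] [d gd]; exists (c * d) => a /=.
  by rewrite (le_trans (fc _))// -mulrA ler_wpM2l.
apply/asboolP; split => /=.
- by move=> k a b /=; rewrite Tl Sl.
- by move=> k a b /=; rewrite Sr Tr.
- exact: bnd.
- exact: bnd.
- by move=> a b; rewrite TL SL.
- by move=> a b; rewrite SR TR.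
- by move=> a b; rewrite SLR TLR.
Qed.

Definition mult_mul S T := Multiplier (mult_mul_subproof S T).

Lemma mult_star_subproof (T : multiplier) :
  ((fun a => cstar ((mval T).2 (cstar a))), (fun a => cstar ((mval T).1 (cstar a))))
    \in is_double_centralizer.
Proof.
have [Tl Tr Tbl Tbr TL TR TLR] := multP T.
have lin (f : A -> A) : linear f -> linear (fun a => cstar (f (cstar a))).
  by move=> fl k a b; rewrite cstarD cstarZ fl cstarD cstarZ conjCK.
have bnd (f : A -> A) : (exists k : R[i], forall a, `|f a| <= k * `|a|) ->
    exists k : R[i], forall a, `|cstar (f (cstar a))| <= k * `|a|.
  by move=> [k fk]; exists k => a; rewrite norm_cstar -[`|a|]norm_cstar.
apply/asboolP; split => /=.
- exact: lin.
- exact: lin.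
- exact: bnd.
- exact: bnd.
- by move=> a b; rewrite cstarM TR cstarM cstarK.
- by move=> a b; rewrite cstarM TL cstarM cstarK.
- by move=> a b; rewrite -[a in LHS]cstarK -cstarM -TLR cstarM cstarK.
Qed.

Definition mult_star T := Multiplier (mult_star_subproof T).

Lemma mult_mulA S T U :
  mult_mul S (mult_mul T U) = mult_mul (mult_mul S T) U.
Proof. exact: mult_eq. Qed.

Lemma mult_mulDl S T U : mult_mul (S + T) U = mult_mul S U + mult_mul T U.
Proof. exact: mult_eq. Qed.

Lemma mult_mulDr S T U : mult_mul S (T + U) = mult_mul S T + mult_mul S U.
Proof.
apply: mult_eq => a /=; rewrite fctE/=.
have [Sl _ _ _ _ _ _] := multP S.
by have := Sl 1 ((mval T).1 a) ((mval U).1 a); rewrite !scale1r.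
Qed.

Lemma mult_mulZl k S T : mult_mul (k *: S) T = k *: mult_mul S T.
Proof. exact: mult_eq. Qed.

Lemma mult_mulZr k S T : mult_mul S (k *: T) = k *: mult_mul S T.
Proof. by apply: mult_eq => a; exact: multZ. Qed.

Lemma mult_starD S T : mult_star (S + T) = mult_star S + mult_star T.
Proof. by apply: mult_eq => a; exact: cstarD. Qed.

Lemma mult_starZ k S : mult_star (k *: S) = k^* *: mult_star S.
Proof. by apply: mult_eq => a; exact: cstarZ. Qed.

Lemma mult_starM S T :
  mult_star (mult_mul S T) = mult_mul (mult_star T) (mult_star S).
Proof. by apply: mult_eq => a /=; rewrite cstarK. Qed.

Lemma mult_starK S : mult_star (mult_star S) = S.
Proof. by apply: mult_eq => a /=; rewrite !cstarK. Qed.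

Lemma mult_normM S T : `|mult_mul S T| <= `|S| * `|T|.
Proof.
apply: mult_norm_le; first by rewrite mulr_ge0.
move=> a /=; rewrite (le_trans (mult_norm_ub _ _))// -mulrA.
by rewrite ler_wpM2l ?mult_norm_ge0// mult_norm_ub.
Qed.

Lemma mult_norm_star T : `|mult_star T| <= `|T|.
Proof.
apply: mult_norm_le => // a /=; rewrite norm_cstar -[`|a|]norm_cstar.
exact: mult_norm_ubr.
Qed.

Lemma mult_norm_starM T : `|mult_mul (mult_star T) T| = `|T| ^+ 2.
Proof.
apply/eqP; rewrite eq_le; apply/andP; split.
  by rewrite (le_trans (mult_normM _ _))// expr2 ler_wpM2r// mult_norm_star.
have [Tl Tr Tbl Tbr TL TR TLR] := multP T.
set s := `|mult_mul _ _|; have s0 : 0 <= s by exact: normr_ge0.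
rewrite -[leRHS]sqrtCK lerXn2r ?nnegrE ?sqrtC_ge0//.
apply: mult_norm_le; rewrite ?sqrtC_ge0// => a.
rewrite -(@ler_pXn2r _ 2) ?nnegrE ?mulr_ge0 ?sqrtC_ge0// exprMn sqrtCK.
rewrite -cnorm_starM [X in `|X|](_ : _ =
  cmul (cstar a) ((mval (mult_mul (mult_star T) T)).1 a)).
  rewrite (le_trans (cnormM_le _ _))// norm_cstar mulrC expr2 mulrA ler_wpM2r//.
  exact: mult_norm_ub.
by rewrite /= -cstarM -TLR cstarM cstarK.
Qed.

HB.instance Definition _ := isCStarAlgebra.Build R multiplier
  mult_mulA mult_mulDl mult_mulDr mult_mulZl mult_mulZr mult_starD mult_starZ
  mult_starM mult_starK mult_normM mult_norm_starM.

Lemma mult_one_subproof : (idfun, idfun) \in is_double_centralizer.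
Proof. by apply/asboolP; split => //=; exists 1 => a; rewrite mul1r. Qed.

Definition mult_one := Multiplier mult_one_subproof.

Lemma mult_mul1l T : mult_mul mult_one T = T. Proof. exact: mult_eq. Qed.

Lemma mult_mul1r T : mult_mul T mult_one = T. Proof. exact: mult_eq. Qed.

HB.instance Definition _ := isUnitalCStarAlgebra.Build R multiplier
  mult_mul1l mult_mul1r.

Lemma mult_of_subproof (a : A) :
  ((fun b => cmul a b), (fun b => cmul b a)) \in is_double_centralizer.
Proof.
apply/asboolP; split => /=.
- by move=> k b c; rewrite cmulDr cmulZr.
- by move=> k b c; rewrite cmulDl cmulZl.
- by exists `|a| => b; exact: cnormM_le.
- by exists `|a| => b; rewrite mulrC; exact: cnormM_le.
- by move=> b c; rewrite cmulA.
- by move=> b c; rewrite cmulA.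
- by move=> b c; rewrite cmulA.
Qed.

(* the canonical embedding of A into its multiplier algebra *)
Definition mult_of (a : A) : multiplier := Multiplier (mult_of_subproof a).

Lemma mult_of_morphism : star_morphism mult_of.
Proof.
split.
- by move=> k a b; apply: mult_eq => c /=; rewrite cmulDl cmulZl.
- by move=> a b; apply: mult_eq => c /=; rewrite cmulA.
- by move=> a; apply: mult_eq => c /=; rewrite cstarM cstarK.
Qed.

Lemma mult_of_inj : injective mult_of.
Proof.
by move=> a b ab; apply: cmul_inj => c; have := congr1 (fun T => (mval T).1 c) ab.
Qed.

End Multipliers.

Record is_action (G : groupType) (X : Type) (act : G -> X -> X) : Prop := {
  action_1 : forall x, act 1%g x = x ;
  action_M : forall g h x, act (g * h)%g x = act g (act h x)
}.

Record continuous_action (G : topologicalGroupType) (X : topologicalType)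
    (act : G -> X -> X) : Prop := {
  continuous_action_action : is_action act ;
  continuous_action_cont : continuous (fun p : G * X => act p.1 p.2)
}.

Record continuous_cstar_action (R : realType) (G : topologicalGroupType)
    (A : cstarAlgType R) (act : G -> A -> A) : Prop := {
  cstar_action_action : is_action act ;
  cstar_action_morphism : forall g, star_morphism (act g) ;
  cstar_action_cont : forall a, continuous (fun g => act g a)
}.

Definition equivariant (G X Y : Type) (aX : G -> X -> X) (aY : G -> Y -> Y)
    (f : X -> Y) : Prop :=
  forall g x, f (aX g x) = aY g (f x).

(* i : X -> bX is the unit at X of the left adjoint to the inclusion of compact
   Hausdorff spaces into topological spaces. *)
Record stone_cech (X bX : topologicalType) (i : X -> bX) : Prop := {
  stone_cech_compact : compact [set: bX] ;
  stone_cech_hausdorff : hausdorff_space bX ;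
  stone_cech_cont : continuous i ;
  stone_cech_univ : forall (K : topologicalType) (f : X -> K),
    compact [set: K] -> hausdorff_space K -> continuous f ->
    exists! h : bX -> K, continuous h /\ h \o i = f
}.

Record category := Category {
  obj :> Type ;
  hom : obj -> obj -> Type ;
  idm : forall X, hom X X ;
  compm : forall X Y Z, hom Y Z -> hom X Y -> hom X Z ;
  compm_idl : forall X Y (f : hom X Y), compm (idm Y) f = f ;
  compm_idr : forall X Y (f : hom X Y), compm f (idm X) = f ;
  compmA : forall X Y Z W (f : hom Z W) (g : hom Y Z) (h : hom X Y),
    compm f (compm g h) = compm (compm f g) h
}.
Arguments hom {c} X Y.
Arguments idm {c} X.
Arguments compm {c X Y Z} f g.

Record functor (C D : category) := Functor {
  fobj :> C -> D ;
  fmor : forall X Y : C, hom X Y -> hom (fobj X) (fobj Y) ;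
  fmor_id : forall X : C, fmor (idm X) = idm (fobj X) ;
  fmor_comp : forall (X Y Z : C) (f : hom Y Z) (g : hom X Y),
    fmor (compm f g) = compm (fmor f) (fmor g)
}.

Definition is_product (C : category) (I : Type) (A : I -> C) (P : C)
    (pi : forall i, hom P (A i)) : Prop :=
  forall (B : C) (f : forall i, hom B (A i)),
    exists! h : hom B P, forall i, compm (pi i) h = f i.

Definition is_coproduct (C : category) (I : Type) (A : I -> C) (S : C)
    (inj : forall i, hom (A i) S) : Prop :=
  forall (B : C) (f : forall i, hom (A i) B),
    exists! h : hom S B, forall i, compm h (inj i) = f i.

Definition preserves_products (C D : category) (F : functor C D) : Prop :=
  forall (I : Type) (A : I -> C) (P : C) (pi : forall i, hom P (A i)),
    is_product pi -> is_product (fun i => fmor F (pi i)).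

Definition preserves_coproducts (C D : category) (F : functor C D) : Prop :=
  forall (I : Type) (A : I -> C) (S : C) (inj : forall i, hom (A i) S),
    is_coproduct inj -> is_coproduct (fun i => fmor F (inj i)).

(* Objects are the elements of O, morphisms are the maps between the underlying
   types that satisfy mor. *)
Section ConcreteCategory.
Variables (O : Type) (car : O -> Type)
  (mor : forall X Y : O, (car X -> car Y) -> Prop).
Arguments mor : clear implicits.
Hypothesis mor_id : forall X, mor X X idfun.
Hypothesis mor_comp : forall X Y Z (f : car Y -> car Z) (g : car X -> car Y),
  mor Y Z f -> mor X Y g -> mor X Z (f \o g).

Let sval_eq (X Y : O) (f g : {f : car X -> car Y | mor X Y f}) :
  sval f = sval g -> f = g.
Proof. by case: f g => [f mf] [g mg] /= fg; exact: eq_exist. Qed.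

Definition concrete_category : category.
Proof.
refine (@Category O (fun X Y => {f : car X -> car Y | mor X Y f})
  (fun X => exist _ idfun (mor_id X))
  (fun X Y Z f g => exist _ (sval f \o sval g) (mor_comp (svalP f) (svalP g)))
  _ _ _).
- by move=> X Y f; exact: sval_eq.
- by move=> X Y f; exact: sval_eq.
- by move=> X Y Z W f g h; exact: sval_eq.
Defined.

End ConcreteCategory.

Section CompactHausdorff.

Record compHaus := CompHaus {
  ch_space :> topologicalType ;
  ch_compact : compact [set: ch_space] ;
  ch_hausdorff : hausdorff_space ch_space
}.

Let cont_id (X : compHaus) : continuous (@idfun X).
Proof. by move=> x; exact: cvg_id. Qed.

Let cont_comp (X Y Z : compHaus) (f : Y -> Z) (g : X -> Y) :
  continuous f -> continuous g -> continuous (f \o g).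
Proof. by move=> cf cg x; apply: continuous_comp; [exact: cg|exact: cf]. Qed.

Definition compHaus_cat : category := concrete_category cont_id cont_comp.

Variable G : topologicalGroupType.

Record compHausAct := CompHausAct {
  cha_space :> compHaus ;
  cha_act : G -> cha_space -> cha_space ;
  cha_actP : continuous_action cha_act
}.

Definition compHausAct_mor (X Y : compHausAct) (f : X -> Y) : Prop :=
  continuous f /\ equivariant (@cha_act X) (@cha_act Y) f.

Let mor_id (X : compHausAct) : compHausAct_mor (@idfun X).
Proof. by split=> //; exact: cont_id. Qed.

Let mor_comp (X Y Z : compHausAct) (f : Y -> Z) (g : X -> Y) :
  compHausAct_mor f -> compHausAct_mor g -> compHausAct_mor (f \o g).
Proof.
move=> [cf ef] [cg eg]; split; first exact: cont_comp.
by move=> h x /=; rewrite eg ef.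
Qed.

Definition compHausAct_cat : category := concrete_category mor_id mor_comp.

Definition forget_compHaus : functor compHausAct_cat compHaus_cat :=
  @Functor compHausAct_cat compHaus_cat cha_space
    (fun X Y f => exist _ (sval f) (svalP f).1)
    (fun X => eq_exist _ _ erefl) (fun X Y Z f g => eq_exist _ _ erefl).

End CompactHausdorff.

Section UnitalCStar.
Variable R : realType.

Definition unital_star_morphism (A B : unitalCStarAlgType R) (f : A -> B) :
  Prop := star_morphism f /\ f cone = cone.

Let ustar_id (A : unitalCStarAlgType R) : unital_star_morphism (@idfun A).
Proof. by []. Qed.

Let ustar_comp (A B C : unitalCStarAlgType R) (f : B -> C) (g : A -> B) :
  unital_star_morphism f -> unital_star_morphism g ->
  unital_star_morphism (f \o g).
Proof.
move=> [[fl fM fs] f1] [[gl gM gs] g1]; split; last by rewrite /= g1 f1.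
split => /=.
- by move=> k x y /=; rewrite gl fl.
- by move=> x y; rewrite gM fM.
- by move=> x; rewrite gs fs.
Qed.

Definition ucstar_cat : category := concrete_category ustar_id ustar_comp.

Variable G : topologicalGroupType.

Record ucstarAct := UCStarAct {
  uca_alg :> unitalCStarAlgType R ;
  uca_act : G -> uca_alg -> uca_alg ;
  uca_actP : continuous_cstar_action uca_act
}.

Definition ucstarAct_mor (A B : ucstarAct) (f : A -> B) : Prop :=
  unital_star_morphism f /\ equivariant (@uca_act A) (@uca_act B) f.

Let mor_id (A : ucstarAct) : ucstarAct_mor (@idfun A).
Proof. by []. Qed.

Let mor_comp (A B C : ucstarAct) (f : B -> C) (g : A -> B) :
  ucstarAct_mor f -> ucstarAct_mor g -> ucstarAct_mor (f \o g).
Proof.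
move=> [uf ef] [ug eg]; split; first exact: ustar_comp.
by move=> h x /=; rewrite eg ef.
Qed.

Definition ucstarAct_cat : category := concrete_category mor_id mor_comp.

Definition forget_ucstar : functor ucstarAct_cat ucstar_cat :=
  @Functor ucstarAct_cat ucstar_cat uca_alg
    (fun A B f => exist _ (sval f) (svalP f).1)
    (fun A => eq_exist _ _ erefl) (fun A B C f g => eq_exist _ _ erefl).

End UnitalCStar.

(* Main.v *)
Require Import Defs.
From HB Require Import structures.
From mathcomp Require Import all_boot all_order all_algebra.
From mathcomp Require Import complex.
From mathcomp Require Import all_classical all_reals topology normedtype sequences.

(* If G is discrete, continuity in the group variable is vacuous: actions lift
   to beta X by functoriality and to M(A) by conjugation with the (contractive)
   automorphisms of A, the l^infinity-product of C*-algebras with G-action is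
   a product with and without the action, and forgetting the action on compact
   spaces has the right adjoint B |-> B^G.

   Conversely, let X0 be the one-point compactification of G and, for g != 1,
   let F_g : X0 -> [0, 1] be continuous with F_g(1) = 0 and F_g(g) = 1, so that
   translating F_g by g moves it by 1 in the sup norm. An action on a compact
   space translates each continuous function, and a continuous action on
   a C*-algebra moves each element, norm-continuously. Each of the conditions
   makes of the family (F_g)_g a single such function or element: a continuous
   function on the Stone-Cech compactification, or on the coproduct, of G-many
   copies of X0; an element of the product of G-many copies of the algebra A0
   of functions on X0 with norm-continuous orbits; a multiplier of c_0(G, A0).
   Hence some neighbourhood of 1 in G contains no g != 1. *)

Set Implicit Arguments.
Unset Strict Implicit.
Unset Printing Implicit Defensive.

Import Order.TTheory GRing.Theory Num.Theory.
Import numFieldNormedType.Exports.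

Local Open Scope classical_set_scope.
Local Open Scope ring_scope.

(** * Actions of topological groups *)

Section TopologicalGroups.
Variable G : topologicalGroupType.

Lemma cvg_mulg (T : Type) (F : set_system T) (FF : Filter F) (f h : T -> G)
    (a b : G) : f @ F --> a -> h @ F --> b ->
  (fun x => (f x * h x)%g) @ F --> (a * b)%g.
Proof.
move=> fa hb; apply: (@cvg_comp _ _ _ (fun x => (f x, h x))
  (fun p : G * G => (p.1 * p.2)%g)); first exact: (cvg_pair fa hb).
exact: (@mulg_continuous G (a, b)).
Qed.

Lemma lmulg_continuous (g : G) : continuous (fun x : G => (g * x)%g).
Proof.
move=> x; apply: (@cvg_mulg G (nbhs x) _ (fun=> g) id g x) => //.
exact: cvg_cst.
Qed.

(** The map [y |-> x^-1 y] is continuous and sends [x] to [1], so isolation of [1] spreads to every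
    point. *)
Lemma discrete_group : (\forall g \near (1%g : G), g = 1%g) ->
  forall U : set G, open U.
Proof.
move=> G1 U; rewrite openE => x Ux.
have := @lmulg_continuous x^-1%g x [set y | y = 1%g].
rewrite mulVg => /(_ G1); apply: (@filterS _ (nbhs x)) => y /= xy1.
suff -> : y = x by [].
by rewrite -[y](mulVKg x) xy1 mulg1.
Qed.

Lemma near_discrete (X : topologicalType) : (forall U : set X, open U) ->
  forall x : X, \forall y \near x, y = x.
Proof. by move=> oX x; apply: open_nbhs_nbhs; split. Qed.

Lemma continuous_action_act (X : topologicalType) (act : G -> X -> X) (g : G) :
  continuous_action act -> continuous (act g).
Proof.
move=> [_ cact] x.
apply: (@cvg_comp _ _ _ (fun y => (g, y)) (fun p : G * X => act p.1 p.2));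
  last exact: (cact (g, x)).
by apply: cvg_pair; [exact: cvg_cst|exact: cvg_id].
Qed.

Lemma discrete_continuous_action (X : topologicalType) (act : G -> X -> X) :
  (forall U : set G, open U) -> is_action act ->
  (forall g, continuous (act g)) -> continuous_action act.
Proof.
move=> oG actG act_cont; split=> // -[g x] U /= Ux.
exists ([set g], act g @^-1` U) => /=.
  by split; [exact: near_discrete | exact: act_cont].
by move=> [h y] /= [-> ].
Qed.

(** The map [(k, g) |-> F (g k) - F k] is continuous and vanishes on [K x {1}]; compactness of [K]
    makes one neighbourhood of [1] serve all [k]. *)
Lemma action_equicontinuous (R : realType) (K : topologicalType)
    (act : G -> K -> K) (F : K -> R) (e : R) :
  compact [set: K] -> continuous_action act -> continuous F -> 0 < e ->
  \forall g \near (1%g : G), forall k, `|F (act g k) - F k| < e.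
Proof.
move=> cK [[act1 actM] cact] cF e0.
have cFact (k : K) : (fun p : K * G => F (act p.2 p.1)) @ (k, 1%g) --> F k.
  rewrite -[in X in _ --> X](act1 k).
  apply: (@cvg_comp _ _ _ (fun p : K * G => act p.2 p.1) F); last exact: cF.
  apply: (@cvg_comp _ _ _ (fun p : K * G => (p.2, p.1)) (fun p => act p.1 p.2)).
    exact: (@swap_continuous _ _ (k, 1%g)).
  exact: (cact (1%g, k)).
have cF1 (k : K) : (fun p : K * G => F p.1) @ (k, 1%g) --> F k.
  by apply: (@cvg_comp _ _ _ fst F); [exact: cvg_fst|exact: cF].
have near_small (k : K) : [set: K] k ->
    \forall k' \near k & g \near (1%g : G), `|F (act g k') - F k'| < e.
  move=> _.
  have Fk0 : (fun p : K * G => F (act p.2 p.1) - F p.1) @ (k, 1%g) --> (0 : R).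
    by rewrite -(subrr (F k)); apply: cvgB; [exact: cFact|exact: cF1].
  suff : nbhs (k, 1%g) (fun p : K * G => `|F (act p.2 p.1) - F p.1| < e) by [].
  by apply: (cvgr_norm_lt _ Fk0); rewrite normr0.
have := (compact_near_coveringP [set: K]).1 cK _ _
  (fun (g : G) k => `|F (act g k) - F k| < e) (nbhs_filter 1%g) near_small.
by apply: (@filterS _ (nbhs (1%g : G))) => g gP k; exact: gP.
Qed.

(** The point [s g] may vary with [g], but the gap [e] may not: equicontinuity then excludes every
    [g != 1] near [1]. *)
Lemma discrete_of_displaced (R : realType) (K : topologicalType)
    (act : G -> K -> K) (F : K -> R) (s : G -> K) (e : R) :
  compact [set: K] -> continuous_action act -> continuous F -> 0 < e ->
  (forall g, g != 1%g -> e <= `|F (act g (s g)) - F (s g)|) ->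
  forall U : set G, open U.
Proof.
move=> cK cact cF e0 Fs; apply: discrete_group.
have := action_equicontinuous cK cact cF e0; apply: (@filterS _ (nbhs (1%g : G))) => g gF.
by apply: contrapT => /eqP/Fs; rewrite leNgt gF.
Qed.

End TopologicalGroups.

(** * Left translation on the one-point compactification *)

Section OnePointCompactification.
Variable G : topologicalGroupType.
Hypotheses (hausG : hausdorff_space G) (lcG : locally_compact [set: G]).

Local Notation opG := (one_point_compactification G).

Definition opc_act (g : G) : opG -> opG := omap (fun h => (g * h)%g).

Lemma opc_act_continuous : continuous_action opc_act.
Proof.
split.
  split=> [[x|]|g h [x|]] //=; first by rewrite mul1g.
  by rewrite mulgA.
move=> -[g [x|]] /=.
  move=> U /= /(@mulg_continuous G (g, x))[/= [V W] /= [Vg Wx] VWU].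
  exists (V, Some @` W); first by split => //; exact: one_point_compactification_some_nbhs.
  by move=> [h _] /= [Vh [y Wy <-]]; exact: (VWU (h, y)).
move=> U [K [cK clK] KU].
have [V] := lcG I (x := g); rewrite withinET => Vg [cV clV].
(* At infinity: for [h] in the compact neighbourhood [V] of [g], [h z] can lie in [K] only if [z]
   lies in the compact set [V^-1 K]. *)
pose K' := [set (p.1^-1 * p.2)%g | p in V `*` K].
have cK' : compact K'.
  apply: continuous_compact; last exact: compact_setX.
  apply: continuous_subspaceT => p.
  apply: (@cvg_mulg _ _ _ _ (fun p : G * G => p.1^-1%g) snd).
  - apply: (@continuous_comp _ _ _ fst (fun x : G => x^-1%g)); first exact: cvg_fst.
    exact: invg_continuous.
  - exact: cvg_snd.
exists (V, (Some @` ~` K') `|` [set None]) => /=.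
  by split => //; exists K' => //; split => //; exact: compact_closed.
move=> [h y] /= [Vh [[z K'z <-]|->]] /=; apply: KU; last by right.
left; exists (h * z)%g => // Khz; apply: K'z; exists (h, (h * z)%g) => //=.
by rewrite mulKg.
Qed.

End OnePointCompactification.

(** * Compactifications defined by functions *)

Lemma compact_set_type (T : topologicalType) (A : set T) :
  compact A -> compact [set: A].
Proof.
move=> cA F FF _.
have [|p [Ap Fp]] := cA (set_val @ F) _.
  by apply: (@filterS _ F _ setT) => [x _|]; [exact: set_valP|exact: filterT].
exists (exist _ p (mem_set Ap)); split => // U V FU [_ [[/= W] oW <- /= Wp] WV].
have [_ [[x Ux <-] Wx]] : (set_val @` U) `&` W !=set0.
  apply: Fp; last exact: open_nbhs_nbhs.
  by apply: (@filterS _ F _ U) => // x Ux; exists x.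
by exists x; split => //; exact: WV.
Qed.

Lemma hausdorff_set_type (T : topologicalType) (A : set T) :
  hausdorff_space T -> hausdorff_space A.
Proof.
move=> hT p q pq; apply: val_inj; apply: hT => U V pU qV.
have [x [Ux Vx]] := pq _ _ (initial_continuous pU) (initial_continuous qV).
by exists (set_val x).
Qed.

Lemma continuous_to_set_type (S T : topologicalType) (A : set T) (f : S -> A) :
  continuous (set_val \o f) -> continuous f.
Proof. exact: continuous_comp_initial. Qed.

Lemma continuous_to_prod (S : topologicalType) (I : Type)
    (T : I -> topologicalType) (f : S -> prod_topology T) :
  (forall i, continuous (fun s => f s i)) -> continuous f.
Proof.
move=> cf s; apply/cvg_sup => i.
by apply: (@continuous_comp_initial _ _ _ (fun g : prod_topology T => g i)); exact: cf.
Qed.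

Lemma continuous_prod_eval (I : Type) (T : I -> topologicalType) (i : I) :
  continuous (fun g : prod_topology T => g i).
Proof. exact: (@proj_continuous {classic I} T i). Qed.

(** A compact Hausdorff space is normal, hence completely regular; [f] separates [k] from the
    complement of the interior of [V]. *)
Lemma completely_regular_nbhs (R : realType) (K : topologicalType) (k : K)
    (V : set K) :
  compact [set: K] -> hausdorff_space K -> nbhs k V ->
  exists f : K -> R, [/\ continuous f, forall x, 0 <= f x <= 1,
    f k = 0 & forall x, ~ V x -> f x = 1].
Proof.
move=> cK hK kV.
have cr := @normal_completely_regular R K (compact_normal hK cK) (hausdorff_accessible hK).
have /(@uniform_separatorP _ R)[f [cf f01 f0 f1]] : uniform_separator [set k] (~` V°).
  by apply: cr; [rewrite closedC; exact: open_interior|apply].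
exists f; split => //.
- by move=> x; have := f01 (f x) (ex_intro2 _ _ x I erefl); rewrite /= in_itv.
- by apply: f0; exists k.
- by move=> x nVx; apply: f1; exists x => // /interior_subset.
Qed.

Section Compactification.
Variables (R : realType) (X : Type) (E : set (X -> R)).
Hypothesis E01 : forall F, E F -> forall x, 0 <= F x <= 1.

Definition cptf_eval (x : X) : prod_topology (fun _ : E => R) :=
  fun F => set_val F x.

(* With E all the continuous functions X -> [0, 1] this is the Stone-Cech
   compactification, with E the equicontinuous ones the largest
   compactification that inherits an action on X. *)
Definition cptf : topologicalType := closure (range cptf_eval).

Lemma cptf_unit_subproof x : cptf_eval x \in closure (range cptf_eval).
Proof. by apply/mem_set/subset_closure; exists x. Qed.

Definition cptf_unit (x : X) : cptf :=
  (exist _ (cptf_eval x) (cptf_unit_subproof x) : closure (range cptf_eval)).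

Lemma cptf_compact : compact [set: cptf].
Proof.
apply: compact_set_type.
pose cube := [set f : prod_topology (fun _ : E => R) | forall F, `[0, 1]%classic (f F)].
have cB : compact cube.
  by apply: (@tychonoff E (fun=> R) (fun=> `[0, 1]%classic)) => _; exact: segment_compact.
have clB : closed cube.
  apply: compact_closed => //; apply: (@hausdorff_product E (fun=> R)) => _; exact: Rhausdorff.
apply: subclosed_compact cB _; first exact: closed_closure.
rewrite [X in _ `<=` X]((closure_id _).1 clB).
apply: closureS => _ [x _ <-] F /=; rewrite in_itv /= E01 //.
exact: set_valP.
Qed.

Lemma cptf_hausdorff : hausdorff_space cptf.
Proof.
by apply: hausdorff_set_type; apply: hausdorff_product => _; exact: Rhausdorff.
Qed.

Definition cptf_coord (F : E) (s : cptf) : R := (set_val s : prod_topology _) F.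

Lemma cptf_coord_continuous F : continuous (cptf_coord F).
Proof.
move=> s; apply: (@cvg_comp _ _ _ set_val (fun g : prod_topology (fun _ : E => R) => g F)).
  exact: initial_continuous.
exact: (@continuous_prod_eval E (fun=> R)).
Qed.

Lemma cptf_coord_unit F x : cptf_coord F (cptf_unit x) = set_val F x.
Proof. by []. Qed.

Lemma continuous_to_cptf (T : topologicalType) (f : T -> cptf) :
  (forall F, continuous (cptf_coord F \o f)) -> continuous f.
Proof.
move=> cf; apply: continuous_to_set_type.
by apply: continuous_to_prod => F; exact: cf.
Qed.

Lemma cptf_unit_dense (s : cptf) W : nbhs s W -> exists x, W (cptf_unit x).
Proof.
move=> [_ [[/= V] oV <- /= Vs] VW].
have [_ [[x _ <-] Vx]] := set_valP s V (open_nbhs_nbhs (conj oV Vs)).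
by exists x; exact: VW.
Qed.

Lemma cptf_unit_epi (K : topologicalType) (f g : cptf -> K) :
  hausdorff_space K -> continuous f -> continuous g ->
  f \o cptf_unit =1 g \o cptf_unit -> f = g.
Proof.
move=> hK cf cg fg; apply/funext => s; apply: hK => U V fU gV.
have [x [Ux Vx]] : exists x, (f @^-1` U `&` g @^-1` V) (cptf_unit x).
  by apply: (@cptf_unit_dense s); apply: filterI; [exact: cf|exact: cg].
by exists (f (cptf_unit x)); split => //; have := fg x; rewrite /= => ->.
Qed.

(** A point of [K] is determined by the values there of the continuous [h : K -> [0, 1]], and [s]
    prescribes these values: they are its coordinates at [h \o f], which lies in [E] by
    hypothesis. *)
Lemma cptf_extend (K : topologicalType) (f : X -> K) :
  compact [set: K] -> hausdorff_space K ->
  (forall h : K -> R, continuous h -> (forall k, 0 <= h k <= 1) -> E (h \o f)) ->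
  exists2 g : cptf -> K, continuous g & g \o cptf_unit =1 f.
Proof.
move=> cK hK Ef.
pose lift (h : {h : K -> R | continuous h /\ forall k, 0 <= h k <= 1}) : E :=
  exist _ (sval h \o f) (mem_set (Ef _ (svalP h).1 (svalP h).2)).
have ex s : exists k : K, forall h, sval h k = cptf_coord (lift h) s.
  (* The trace on [X] of the neighbourhoods of [s], proper by density. A cluster point of its image
     under [f] has the prescribed values, as these are the limits of the [h \o f] along it. *)
  pose FX : set_system X := filter_from (nbhs s) (fun W => cptf_unit @^-1` W).
  have FXP : ProperFilter FX.
    apply: filter_from_proper; last exact: cptf_unit_dense.
    apply: filter_from_filter; first by exists setT; exact: filterT.
    by move=> U V sU sV; exists (U `&` V) => //; exact: filterI.
  have [k [_ FXk]] := cK (f @ FX) (fmap_proper_filter f FXP) filterT.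
  exists k => h; apply: Rhausdorff => U V hkU sV.
  have [||_ [[x Vx <-] Ux]] := FXk (f @` (cptf_unit @^-1` (cptf_coord (lift h) @^-1` V)))
      (sval h @^-1` U).
  - exists (cptf_coord (lift h) @^-1` V); first exact: cptf_coord_continuous.
    by move=> x Vx; exists x.
  - exact: (svalP h).1.
  by exists (sval h (f x)).
(* gP determines g s, as the functions h separate the points of K. *)
have [g gP] := choice ex.
(* Some [h] vanishes at [k] and is [1] off [V], so the open condition [< 1] on a single coordinate
   forces [g s] into [V]. This serves both the continuity of [g] and its agreement with [f] on
   [X]. *)
have cut k V : nbhs k V -> exists h, sval h k = 0 /\
    forall s, cptf_coord (lift h) s < 1 -> V (g s).
  move=> kV; have [h [ch h01 h0 h1]] := completely_regular_nbhs R cK hK kV.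
  exists (exist _ h (conj ch h01)); split => // s; rewrite -gP /= => hs.
  by apply: contrapT => /h1 h1s; rewrite h1s ltxx in hs.
exists g.
  move=> s V /cut[h [h0 hV]].
  have : nbhs s (cptf_coord (lift h) @^-1` [set r | r < 1]).
    apply: cptf_coord_continuous; apply: open_nbhs_nbhs; split; first exact: open_lt.
    by rewrite /= -gP h0.
  by apply: (@filterS _ (nbhs s)) => t; exact: hV.
move=> x /=; apply: hK => U V gxU fxV.
have [h [h0 hV]] := cut _ _ fxV.
exists (g (cptf_unit x)); split; first exact: nbhs_singleton.
apply: hV; have -> : cptf_coord (lift h) (cptf_unit x) = 0 by exact: h0.
exact: ltr01.
Qed.

End Compactification.

Section CptfMap.
Variables (R : realType) (X : Type) (E : set (X -> R)).

(** Composition with [phi] reindexes the coordinates of the product, which is continuous and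
    preserves the closure of the image of [X]. Allowing any [F'] with the right underlying function
    leaves the proof of membership in [E] to the user. *)
Lemma cptf_map (phi : X -> X) : (forall F, E F -> E (F \o phi)) ->
  exists f : cptf E -> cptf E, [/\ continuous f,
    forall F F' : E, set_val F' = (set_val F : X -> R) \o phi ->
      forall s, cptf_coord F (f s) = cptf_coord F' s &
    f \o @cptf_unit R X E =1 @cptf_unit R X E \o phi].
Proof.
move=> Ephi.
pose P := prod_topology (fun _ : E => R).
pose pull (F : E) : E := exist _ (set_val F \o phi) (mem_set (Ephi _ (set_valP F))).
pose Phi (p : P) : P := fun F => p (pull F).
have cPhi : continuous Phi.
  by apply: continuous_to_prod => F; exact: (@continuous_prod_eval E (fun=> R)).
have PhiS (s : cptf E) : Phi (set_val s) \in closure (range (@cptf_eval R X E)).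
  apply/mem_set => U /cPhi PhiU.
  have [_ [[x _ <-] Ux]] := set_valP s _ PhiU.
  by exists (cptf_eval (phi x)); split; [exists (phi x)|].
pose f (s : cptf E) : cptf E :=
  (exist _ (Phi (set_val s)) (PhiS s) : closure (range (@cptf_eval R X E))).
exists f; split.
- apply: continuous_to_set_type => s.
  apply: (@cvg_comp _ _ _ set_val Phi); first exact: initial_continuous.
  exact: cPhi.
- move=> F F' FF' s; rewrite (_ : F' = pull F)//.
  exact: val_inj.
- by move=> x; apply: val_inj.
Qed.

(** Coordinates are continuous and the image of [X] is dense, so a violation at [s] would already
    occur at a point of [X]. *)
Lemma cptf_coord_le (F F' : E) (e : R) :
  (forall x, `|(set_val F : X -> R) x - (set_val F' : X -> R) x| <= e) ->
  forall s, `|cptf_coord F s - cptf_coord F' s| <= e.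
Proof.
move=> FF' s; rewrite leNgt; apply/negP => es.
have cd : (fun t => `|cptf_coord F t - cptf_coord F' t|) @ s -->
    `|cptf_coord F s - cptf_coord F' s|.
  have cB : (fun t => cptf_coord F t - cptf_coord F' t) @ s -->
      cptf_coord F s - cptf_coord F' s.
    apply: cvgB; first exact: (@nbhs_filter (cptf E)).
    - exact: cptf_coord_continuous.
    - exact: cptf_coord_continuous.
  exact: (cvg_norm cB).
have [|x] := @cptf_unit_dense R X E s [set t | e < `|cptf_coord F t - cptf_coord F' t|].
  exact: (cvgr_gt _ cd).
by rewrite /= !cptf_coord_unit ltNge FF'.
Qed.

End CptfMap.

(** * The compactification by equicontinuous functions *)

Section EquicontinuousCompactification.
Variables (R : realType) (G : topologicalGroupType) (X : topologicalType).
Variable act : G -> X -> X.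
Hypothesis actX : continuous_action act.

(** By [action_equicontinuous], every continuous [[0, 1]]-valued function on a compact [G]-space,
    pulled back along a continuous equivariant map, satisfies these conditions. *)
Definition equi_fun : set (X -> R) := [set F : X -> R | [/\ continuous F,
  forall x, 0 <= F x <= 1 &
  forall e, 0 < e -> \forall g \near (1%g : G), forall x, `|F (act g x) - F x| < e]].

(** [F (g h x) - F (g x)] is the displacement of [F] at [g x] by [g h g^-1], which tends to [1] with
    [h]. *)
Lemma equi_fun_act g F : equi_fun F -> equi_fun (F \o act g).
Proof.
have [[act1 actM] cact] := actX.
move=> [cF F01 Fe]; split => [x|x|e /Fe e0].
- by apply: (@cvg_comp _ _ _ (act g) F); [exact: (continuous_action_act (g := g) actX)|exact: cF].
- exact: F01.
have : (fun h => g * h * g^-1)%g @ (1%g : G) --> (1%g : G).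
  rewrite -[X in _ --> X](mulgV g) -[X in (X * _)%g](mulg1 g).
  by apply: cvg_mulg; [apply: cvg_mulg; [exact: cvg_cst|exact: cvg_id]|exact: cvg_cst].
move=> /(_ _ e0); apply: (@filterS _ (nbhs (1%g : G))) => h /= he x.
have := he (act g x); rewrite -actM.
by rewrite -mulgA mulVg mulg1 actM.
Qed.

Definition equi_cpt := cptf equi_fun.
Definition equi_unit : X -> equi_cpt := @cptf_unit R X equi_fun.

Lemma equi_fun01 F : equi_fun F -> forall x, 0 <= F x <= 1.
Proof. by case. Qed.

Lemma equi_unit_continuous : continuous equi_unit.
Proof.
apply: continuous_to_cptf => F.
by have [cF _ _] : equi_fun (set_val F) := set_valP F.
Qed.

(** Each [act g] extends by [cptf_map], and density carries over the group laws. Joint continuity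
    splits into moving [g], uniformly in [s] by equicontinuity, and moving [s] with [g0] fixed. *)
Lemma equi_cpt_act : exists2 sact : G -> equi_cpt -> equi_cpt,
  continuous_action sact & equivariant act sact equi_unit.
Proof.
have [[act1 actM] cact] := actX.
have /choice[sact sactP] (g : G) := cptf_map (@equi_fun_act g).
have sact_unit g x : sact g (equi_unit x) = equi_unit (act g x).
  by have [_ _ /(_ x)] := sactP g.
have csact g : continuous (sact g) by have [] := sactP g.
pose pull (F : equi_fun) g : equi_fun :=
  exist _ (set_val F \o act g) (mem_set (equi_fun_act g (set_valP F))).
have sact_coord g F s : cptf_coord F (sact g s) = cptf_coord (pull F g) s.
  by have [_ /(_ F (pull F g) erefl)] := sactP g.
exists sact; last by move=> g x; rewrite sact_unit.
split.
  split=> [s|g h s].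
    apply: (congr1 (fun f => f s)); apply: cptf_unit_epi => //.
    - exact: cptf_hausdorff.
    - by move=> t; exact: cvg_id.
    - by move=> x /=; rewrite sact_unit act1.
  apply: (congr1 (fun f => f s) (_ : sact (g * h)%g = sact g \o sact h)).
  apply: cptf_unit_epi => //.
  - exact: cptf_hausdorff.
  - by move=> t; apply: (@cvg_comp _ _ _ (sact h) (sact g)); exact: csact.
  - by move=> x /=; rewrite !sact_unit actM.
apply: continuous_to_cptf => F -[g0 s0] /=.
apply/cvgrPdist_lt => e e0 /=.
have e20 : 0 < e / 2 by rewrite divr_gt0.
(* On [X], [g x] is the translate of [g0 x] by [g g0^-1], which is near [1]. *)
have g0e : \forall g \near g0, forall s,
    `|cptf_coord F (sact g0 s) - cptf_coord F (sact g s)| <= e / 2.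
  have [_ _ /(_ _ e20)] : equi_fun (set_val F) := set_valP F.
  have : (fun g => g * g0^-1)%g @ g0 --> (1%g : G).
    rewrite -[X in _ --> X](mulgV g0).
    by apply: cvg_mulg; [exact: cvg_id|exact: cvg_cst].
  move=> /[apply]; apply: (@filterS _ (nbhs g0)) => g /= ge s.
  rewrite !sact_coord; apply: cptf_coord_le => x /=.
  by have := ge (act g0 x); rewrite -actM mulgVK distrC => /ltW.
have s0e : \forall s \near s0,
    `|cptf_coord F (sact g0 s0) - cptf_coord F (sact g0 s)| < e / 2.
  have : (cptf_coord F \o sact g0) @ s0 --> cptf_coord F (sact g0 s0).
    apply: (@cvg_comp _ _ _ (sact g0) (cptf_coord F)); first exact: csact.
    exact: cptf_coord_continuous.
  by move=> /cvgrPdist_lt/(_ _ e20).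
exists ([set g | forall s, `|cptf_coord F (sact g0 s) - cptf_coord F (sact g s)| <= e / 2],
  [set s | `|cptf_coord F (sact g0 s0) - cptf_coord F (sact g0 s)| < e / 2]) => //.
move=> [g s] /= [gP sP].
rewrite -(subrKA (cptf_coord F (sact g0 s))) [e]splitr.
by rewrite (le_lt_trans (ler_normD _ _))// ltr_leD.
Qed.

(** The existence half of the universal property among compact Hausdorff [G]-spaces: by equivariance
    of [f], [h \o f] inherits the equicontinuity that [h] has on [K]. *)
Lemma equi_cpt_extend (K : topologicalType) (kact : G -> K -> K) (f : X -> K) :
  compact [set: K] -> hausdorff_space K -> continuous_action kact ->
  continuous f -> equivariant act kact f ->
  exists2 g : equi_cpt -> K, continuous g & g \o equi_unit =1 f.
Proof.
move=> cK hK actK cf ef; apply: cptf_extend => // h ch h01; split.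
- by move=> x; apply: (@cvg_comp _ _ _ f h); [exact: cf|exact: ch].
- by move=> x; exact: h01.
- move=> e e0; have := action_equicontinuous cK actK ch e0.
  by apply: (@filterS _ (nbhs (1%g : G))) => g ge x /=; rewrite ef.
Qed.

End EquicontinuousCompactification.

(** * Stone-Cech compactifications and coproducts *)

Lemma sval_inj (T : Type) (P : T -> Prop) (x y : {z : T | P z}) :
  sval x = sval y -> x = y.
Proof. by case: x y => [x px] [y py] /= xy; exact: eq_exist. Qed.

Section TopologicalEquivalences.
Variable G : topologicalGroupType.

(** The universal property lifts each [act g], and its uniqueness part lifts the group laws. *)
Lemma discrete_stone_cech (X bX : topologicalType) (i : X -> bX)
    (act : G -> X -> X) :
  (forall U : set G, open U) -> stone_cech i -> continuous_action act ->
  exists2 bact : G -> bX -> bX, continuous_action bact & equivariant act bact i.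
Proof.
move=> oG [cb hb ci univ] actX; have [[act1 actM] cact] := actX.
have /choice[bact bactP] (g : G) : exists h : bX -> bX,
    continuous h /\ h \o i = i \o act g.
  have [|h [hP _]] := univ bX (i \o act g) cb hb; last by exists h.
  move=> x; apply: (@cvg_comp _ _ _ (act g) i); last exact: ci.
  exact: continuous_action_act.
have bact_i g x : bact g (i x) = i (act g x).
  by have [_ /(congr1 (fun f => f x))] := bactP g.
have epi (f h : bX -> bX) : continuous f -> continuous h ->
    f \o i = h \o i -> f = h.
  move=> cf ch fh; have [|k [_ kU]] := univ bX (f \o i) cb hb.
    by move=> x; apply: (@cvg_comp _ _ _ i f); [exact: ci|exact: cf].
  by rewrite -(kU f) // -(kU h).
exists bact; last by move=> g x; rewrite bact_i.
apply: discrete_continuous_action => //; last by move=> g; have [] := bactP g.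
split=> [x|g h x].
  apply: (congr1 (fun f => f x) (_ : bact 1%g = id)); apply: epi.
  - by have [] := bactP 1%g.
  - by move=> y; exact: cvg_id.
  - by apply/funext => y /=; rewrite bact_i act1.
apply: (congr1 (fun f => f x) (_ : bact (g * h)%g = bact g \o bact h)).
apply: epi; first by have [] := bactP (g * h)%g.
  move=> y; apply: (@cvg_comp _ _ _ (bact h) (bact g)).
    by have [+ _] := bactP h; apply.
  by have [+ _] := bactP g; apply.
by apply/funext => y /=; rewrite !bact_i actM.
Qed.

(* B |-> B^G is right adjoint to forgetting the action. *)
Lemma coinduced_continuous_action (B : topologicalType) :
  (forall U : set G, open U) ->
  continuous_action (fun (g : G) (p : prod_topology (fun _ : G => B)) =>
    (fun h => p (h * g)%g) : prod_topology (fun _ : G => B)).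
Proof.
move=> oG; apply: discrete_continuous_action => //.
  by split=> [p|g h p]; apply/funext => k; rewrite ?mulg1 ?mulgA.
by move=> g; apply: continuous_to_prod => h; exact: (@continuous_prod_eval G (fun=> B)).
Qed.

Lemma discrete_preserves_coproducts : (forall U : set G, open U) ->
  preserves_coproducts (forget_compHaus G).
Proof.
move=> oG I A S inj injP B f.
pose P := prod_topology (fun _ : G => B).
have cP : compact [set: P].
  have := @tychonoff G (fun=> B) (fun=> setT) (fun=> @ch_compact B).
  by congr compact; apply/seteqP; split.
have hP : hausdorff_space P.
  by apply: (@hausdorff_product G (fun=> B)) => _; exact: ch_hausdorff.
pose PA := @CompHausAct G (@CompHaus P cP hP) _ (coinduced_continuous_action B oG).
(* The transpose of [f i] under the adjunction; evaluation at [1] recovers [f i]. *)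
pose ft i (a : A i) : P := fun g => sval (f i) (cha_act g a).
have cact (C : compHausAct G) g : continuous (@cha_act G C g).
  exact: continuous_action_act (cha_actP C).
have ftP i : @compHausAct_mor G (A i) PA (ft i).
  split=> [|g a]; last first.
    apply/funext => h; rewrite /ft /=.
    by have [[_ actM] _] := cha_actP (A i); rewrite actM.
  apply: continuous_to_prod => g a.
  apply: (@cvg_comp _ _ _ (cha_act g) (sval (f i))); last exact: (svalP (f i)).
  exact: cact.
have [h [hf hU]] := injP PA (fun i => exist _ (ft i) (ftP i)).
have act1 (C : compHausAct G) (x : C) : cha_act 1%g x = x.
  by have [[-> _] _] := cha_actP C.
have cev (k : S -> P) : continuous k -> continuous (fun s => k s 1%g).
  move=> ck s; apply: (@cvg_comp _ _ _ k (fun p : P => p 1%g)); first exact: ck.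
  exact: (@continuous_prod_eval G (fun=> B)).
exists (exist _ (fun s => sval h s 1%g) (cev _ (svalP h).1)).
split.
  move=> i; apply: sval_inj; apply/funext => a /=.
  by have /(congr1 sval)/(congr1 (fun k => k a 1%g)) := hf i; rewrite /= /ft act1.
move=> k kf.
(* The transpose of the competitor [k] is equivariant and restricts to [ft i] on each summand, so it
   equals [h]. *)
pose kt (s : S) : P := fun g => sval k (cha_act g s).
have ktP : @compHausAct_mor G S PA kt.
  split=> [|g a]; last first.
    apply/funext => h'; rewrite /kt /=.
    by have [[_ actM] _] := cha_actP S; rewrite actM.
  apply: continuous_to_prod => g a.
  apply: (@cvg_comp _ _ _ (cha_act g) (sval k)); last exact: (svalP k).
  exact: cact.
have -> : h = exist _ kt ktP.
  apply: hU => i; apply: sval_inj; apply/funext => a /=; apply/funext => g.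
  rewrite /kt /ft -[in LHS](svalP (inj i)).2.
  by have /(congr1 sval)/(congr1 (fun k => k (cha_act g a))) := kf i.
by apply: sval_inj; apply/funext => s /=; rewrite /kt act1.
Qed.

End TopologicalEquivalences.

Lemma continuous_pair (S T U : topologicalType) (f : S -> T) (g : S -> U) :
  continuous f -> continuous g -> continuous (fun x => (f x, g x)).
Proof. by move=> cf cg x; apply: cvg_pair; [exact: cf|exact: cg]. Qed.

Lemma continuous_compT (S T U : topologicalType) (f : S -> T) (g : T -> U) :
  continuous f -> continuous g -> continuous (g \o f).
Proof. by move=> cf cg x; apply: cvg_comp; [exact: cf|exact: cg]. Qed.

(** * Displaced functions; lifting to Stone-Cech compactifications and preservation of coproducts
    force discreteness *)

Section Displacement.
Variables (R : realType) (G : topologicalGroupType).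
Hypotheses (hausG : hausdorff_space G) (lcG : locally_compact [set: G]).

Local Notation opG := (one_point_compactification G).

Lemma displacing_functions : exists F : G -> opG -> R,
  [/\ forall g, continuous (F g), forall g x, 0 <= F g x <= 1 &
    forall g, g != 1%g ->
      `|F g (opc_act g (Some 1%g)) - F g (Some 1%g)| = 1].
Proof.
have cO : compact [set: opG] := one_point_compactification_compact.
have hO : hausdorff_space opG := one_point_compactification_hausdorff lcG hausG.
have /choice[F FP] (g : G) : exists F : opG -> R,
    [/\ continuous F, forall x, 0 <= F x <= 1 &
      g != 1%g -> `|F (opc_act g (Some 1%g)) - F (Some 1%g)| = 1].
  have [->|g1] := eqVneq g 1%g.
    exists (fun=> 0); split.
    - exact: cst_continuous.
    - by move=> _; rewrite lexx ler01.
    - by [].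
  have : nbhs (Some 1%g : opG) (~` [set Some g]).
    apply: open_nbhs_nbhs; split; last by case=> /esym/eqP; rewrite (negbTE g1).
    by apply: closed_openC; exact: accessible_closed_set1 (hausdorff_accessible hO) _.
  move=> /(completely_regular_nbhs R cO hO)[F [cF F01 F0 F1]].
  exists F; split => // _; rewrite /= mulg1 F0 subr0 F1 ?normr1//.
  by apply; rewrite /=.
by exists F; split => g; have [] := FP g.
Qed.

(* The disjoint union of G-many copies of opG, as a product with a discrete
   factor. *)
Definition opc_sum : topologicalType := (discrete_topology G * opG)%type.

Definition opc_sum_act (g : G) (p : opc_sum) : opc_sum := (p.1, opc_act g p.2).

Lemma opc_sum_act_continuous : continuous_action opc_sum_act.
Proof.
have [[act1 actM] cact] := opc_act_continuous hausG lcG; split.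
  by split=> [[i x]|g h [i x]]; rewrite /opc_sum_act /= ?act1 ?actM.
apply: continuous_pair.
  by move=> p; apply: (@cvg_comp _ _ _ snd fst); [exact: cvg_snd|exact: cvg_fst].
apply: (@continuous_compT _ _ _ (fun p : G * opc_sum => (p.1, p.2.2))
  (fun p => opc_act p.1 p.2)); last exact: cact.
apply: continuous_pair; first by move=> p; exact: cvg_fst.
by move=> p; apply: (@cvg_comp _ _ _ snd snd); exact: cvg_snd.
Qed.

Lemma opc_sum_continuous (T : topologicalType) (f : G -> opG -> T) :
  (forall g, continuous (f g)) ->
  continuous (fun p : opc_sum => f p.1 p.2).
Proof.
move=> cf [i x] V /= fV; exists ([set i], f i @^-1` V).
  split; last exact: cf.
  by apply: open_nbhs_nbhs; split => //; exact: discrete_open.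
by move=> [j y] /= [-> ].
Qed.

Lemma opc_sum_incl_continuous (i : G) : continuous (fun x : opG => (i, x) : opc_sum).
Proof. by apply: continuous_pair; [exact: cst_continuous|move=> x; exact: cvg_id]. Qed.

(** The [F g] glue to one continuous function on [opc_sum], which is a coordinate of its Stone-Cech
    compactification. A continuous action there makes the coordinate equicontinuous, while [g]
    displaces it by [1] at the point [(g, 1)]. *)
Lemma stone_cech_discrete :
  (forall (X bX : topologicalType) (i : X -> bX) (act : G -> X -> X),
    stone_cech i -> continuous_action act ->
    exists2 bact : G -> bX -> bX,
      continuous_action bact & equivariant act bact i) ->
  forall U : set G, open U.
Proof.
move=> lift; have [F [cF F01 Fg]] := displacing_functions.
pose E : set (opc_sum -> R) :=
  [set F : opc_sum -> R | continuous F /\ forall x, 0 <= F x <= 1].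
have E01 F' : E F' -> forall x, 0 <= F' x <= 1 by case.
have sc : stone_cech (@cptf_unit R _ E).
  split; [exact: cptf_compact|exact: cptf_hausdorff| |].
    apply: continuous_to_cptf => F'.
    by have [] : E (set_val F') := set_valP F'.
  move=> K f cK hK cf; have [h ch h01|g cg gf] := @cptf_extend R _ E K f cK hK.
    by split; [exact: (@continuous_compT _ _ _ f h cf ch)|move=> x; exact: h01].
  exists g; split; first by split => //; exact/funext.
  move=> k [ck kf]; apply: cptf_unit_epi => // x; rewrite gf.
  by rewrite -kf.
have [bact actb eqb] := lift _ _ _ _ sc opc_sum_act_continuous.
have EF : E (fun p => F p.1 p.2).
  by split; [exact: opc_sum_continuous|move=> p; exact: F01].
pose FE : E := exist (fun f => f \in E) _ (mem_set EF).
apply: (@discrete_of_displaced _ _ _ bact (cptf_coord FE)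
  (fun g => @cptf_unit R _ E (g, Some 1%g)) 1) => //.
- exact: cptf_compact.
- exact: cptf_coord_continuous.
- by move=> g g1; rewrite -eqb !cptf_coord_unit /= Fg.
Qed.

(** Among compact [G]-spaces, the coproduct of [G]-many copies of [opG] is the equicontinuous
    compactification of [opc_sum]. If it remains a coproduct without the action, the merely
    continuous maps [F g] into [[0, 1]] extend to one continuous function on it, to which
    [discrete_of_displaced] applies. *)
Lemma coproducts_discrete :
  preserves_coproducts (forget_compHaus G) -> forall U : set G, open U.
Proof.
move=> pres; have [F [cF F01 Fg]] := displacing_functions.
pose S := equi_cpt R opc_sum_act.
pose u : opc_sum -> S := @equi_unit R G opc_sum opc_sum_act.
have [sact actS equ] := @equi_cpt_act R G _ _ opc_sum_act_continuous.
have cS : compact [set: S] by apply: cptf_compact => F'; exact: equi_fun01.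
have hS : hausdorff_space S by exact: cptf_hausdorff.
have cu : continuous u by exact: equi_unit_continuous.
pose SA : compHausAct_cat G := @CompHausAct G (@CompHaus S cS hS) _ actS.
pose OA : compHausAct_cat G := @CompHausAct G (@CompHaus opG
  one_point_compactification_compact
  (one_point_compactification_hausdorff lcG hausG)) _ (opc_act_continuous hausG lcG).
have injP i : @compHausAct_mor G OA SA (fun x => u (i, x)).
  split; last by move=> g x; exact: (equ g (i, x)).
  move=> x; apply: (@cvg_comp _ _ _ (fun x : opG => (i, x) : opc_sum) u); last exact: cu.
  exact: opc_sum_incl_continuous.
pose inj (i : G) : Defs.hom OA SA := exist _ _ (injP i).
have coprod : is_coproduct inj.
  move=> B f; pose ff (p : opc_sum) : B := sval (f p.1) p.2.
  have eff : equivariant opc_sum_act (@cha_act G B) ff.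
    by move=> g [i x]; exact: (svalP (f i)).2.
  have cff : continuous ff.
    apply: (opc_sum_continuous (f := fun i => sval (f i))) => i.
    exact: (svalP (f i)).1.
  have [k ck kf] := @equi_cpt_extend R G _ opc_sum_act B _ ff
    (@ch_compact B) (@ch_hausdorff B) (@cha_actP G B) cff eff.
  have kP : @compHausAct_mor G SA B k.
    split => // g s.
    apply: (congr1 (fun f => f s) (_ : k \o sact g = @cha_act G B g \o k)).
    apply: (@cptf_unit_epi R opc_sum (equi_fun opc_sum_act) B).
    - exact: ch_hausdorff.
    - exact: (@continuous_compT S S B (sact g) k (continuous_action_act (g := g) actS) ck).
    - exact: (@continuous_compT S B B k _ ck (continuous_action_act (g := g) (@cha_actP G B))).
    - move=> p; have := kf (opc_sum_act g p); have := kf p; rewrite /= => kp kgp.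
      by rewrite -[cptf_unit _ p]/(u p) -equ kgp kp.
  exists (exist _ k kP); split.
    by move=> i; apply: sval_inj; apply/funext => x /=; exact: (kf (i, x)).
  move=> h hf; apply: sval_inj; apply: cptf_unit_epi.
  - exact: ch_hausdorff.
  - exact: ck.
  - exact: (svalP h).1.
  - move=> [i x]; have := kf (i, x); rewrite /= => ->.
    by have /(congr1 sval)/(congr1 (fun f => f x)) := hf i.
have hI : hausdorff_space `[0 : R, 1]%classic.
  by apply: hausdorff_set_type; exact: Rhausdorff.
pose unitI : compHaus_cat := @CompHaus `[0 : R, 1]%classic
  (compact_set_type (@segment_compact R 0 1)) hI.
have FI i x : F i x \in `[0, 1]%classic by rewrite inE /= in_itv /= F01.
pose FF i (x : opG) : unitI := (exist _ (F i x) (FI i x) : `[0, 1]%classic).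
have cFF i : continuous (FF i) by apply: continuous_to_set_type; exact: cF.
have [h [hf _]] := pres _ _ _ _ coprod unitI (fun i => exist _ _ (cFF i)).
apply: (@discrete_of_displaced G R S sact (fun s => set_val (sval h s))
  (fun g => u (g, Some 1%g)) 1) => //.
- move=> s; apply: (@cvg_comp _ _ _ (sval h) set_val).
    exact: (svalP h).
  exact: initial_continuous.
- move=> g g1; rewrite -equ /opc_sum_act /=.
  have hfx x : set_val (sval h (u (g, x))) = F g x.
    by have /(congr1 sval)/(congr1 (fun f => set_val (f x))) := hf g.
  by rewrite !hfx Fg.
Qed.

End Displacement.

(** * Morphisms of C*-algebras are contractive *)

Lemma complex_gt0_real (R : realType) (e : R[i]) : 0 < e ->
  exists2 r : R, 0 < r & e = r%:C%C.
Proof.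
move=> e0; exists (complex.Re e); last by rewrite RRe_real// ger0_real// ltW.
by rewrite -ltcR RRe_real// ger0_real// ltW.
Qed.

Lemma complex_ge0_real (R : realType) (e : R[i]) : 0 <= e ->
  exists2 r : R, 0 <= r & e = r%:C%C.
Proof.
move=> e0; exists (complex.Re e); last by rewrite RRe_real// ger0_real.
by rewrite -lecR RRe_real// ger0_real.
Qed.

Lemma complex_expr_small (R : realType) (r e : R[i]) : 0 <= r -> r < 1 -> 0 < e ->
  exists N, forall n, (N <= n)%N -> r ^+ n < e.
Proof.
move=> /complex_ge0_real[s s0 ->] s1 /complex_gt0_real[d d0 ->].
have s1' : s < 1 by rewrite -ltcR.
have : s ^+ n @[n --> \oo] --> 0 by apply: cvg_expr; rewrite ger0_norm.
move=> /cvgrPdist_lt/(_ d d0)[N _ NP]; exists N => n /NP.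
rewrite sub0r normrN ger0_norm ?exprn_ge0// => sd.
by rewrite -rmorphXn ltcR.
Qed.

Section CStarBasics.
Variables (R : realType) (A : cstarAlgType R).

Lemma cstarN (x : A) : cstar (- x) = - cstar x.
Proof. by rewrite -scaleN1r cstarZ rmorphN rmorph1 scaleN1r. Qed.

Lemma cstarB (x y : A) : cstar (x - y) = cstar x - cstar y.
Proof. by rewrite cstarD cstarN. Qed.

Lemma half_double (x : A) : (2^-1 : R[i]) *: (x + x) = x.
Proof. by rewrite scalerDr -scalerDl -div1r -splitr scale1r. Qed.

Lemma norm_le_eps (x : A) (c : R[i]) : 0 <= c ->
  (forall e, 0 < e -> `|x| <= e * c) -> x = 0.
Proof.
move=> c0 xc; apply/eqP; rewrite -normr_eq0; apply/eqP.
exact: cstar_le_eps c0 xc.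
Qed.

Lemma cmul_sqrB (x y : A) :
  cmul x x - cmul y y = cmul x (x - y) + cmul (x - y) y.
Proof. by rewrite cmulBr cmulBl subrKA. Qed.

(* y = 1 - sqrt (1 - b^2), as the fixed point of the contraction
   y |-> (b^2 + y^2) / 2 of the ball of radius |b|. *)
Lemma cstar_sqrt (b : A) : cstar b = b -> `|b| < 1 ->
  exists y : A, [/\ cstar y = y, cmul y b = cmul b y &
    y + y - cmul y y = cmul b b].
Proof.
move=> bs b1; pose a := cmul b b; pose r := `|b|.
pose f (y : A) := (2^-1 : R[i]) *: (a + cmul y y).
pose y n := iter n f 0.
have r0 : 0 <= r by exact: normr_ge0.
have half2 : `|2^-1 : R[i]| = 2^-1 by rewrite ger0_norm ?invr_ge0.
have fr x : `|x| <= r -> `|f x| <= r.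
  move=> xr; rewrite normrZ half2 ler_pdivrMl// mulr_natl mulr2n.
  rewrite (le_trans (ler_normD _ _))// lerD// (le_trans (cnormM_le _ _))//.
    by rewrite ler_piMr// ltW.
  by rewrite (le_trans (ler_pM _ _ xr xr))// ler_piMr// ltW.
have fL x z : `|x| <= r -> `|z| <= r -> `|f x - f z| <= r * `|x - z|.
  move=> xr zr; rewrite -scalerBr normrZ half2 ler_pdivrMl//.
  rewrite opprD addrACA subrr add0r cmul_sqrB (le_trans (ler_normD _ _))//.
  rewrite mulr_natl mulr2n lerD// (le_trans (cnormM_le _ _))//.
    by rewrite ler_wpM2r.
  by rewrite mulrC ler_wpM2r.
have yr n : `|y n| <= r by elim: n => [|n IH]; [rewrite normr0|exact: fr].
(* All iterates have norm at most [r < 1], which starts the induction; each application of [f] gains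
   a factor [r]. *)
have yd n k : `|y (n + k)%N - y n| <= r ^+ n.
  elim: n => [|n IH]; first by rewrite subr0 expr0 (le_trans (yr _))// ltW.
  by rewrite addSn (le_trans (fL _ _ (yr _) (yr _)))// exprS ler_wpM2l.
have cy : cvg (y @ \oo).
  apply: cauchy_cvg; apply/cauchy_exP => e /(complex_expr_small r0 b1)[N rN].
  exists (y N), N => // n /= Nn; rewrite -ball_normE /ball_ /= distrC.
  by rewrite -(subnKC Nn) (le_lt_trans (yd _ _))// rN.
pose l := lim (y @ \oo).
(* Both [y n] and [y n.+1] must be near [l], as [y2] relates consecutive iterates. *)
have yl e : 0 < e -> exists n, `|l - y n| <= e /\ `|l - y n.+1| <= e.
  move=> e0; have /cvgrPdist_le/(_ e e0)[N _ yN] := cy.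
  by exists N; split; apply: yN => /=.
have ys n : cstar (y n) = y n.
  elim: n => [|n IH]; first exact: cstar0.
  by rewrite /= -/(y n) /f cstarZ cstarD !cstarM IH bs fmorphV rmorph_nat.
have yb n : cmul (y n) b = cmul b (y n).
  elim: n => [|n IH]; first by rewrite cmul0l cmul0r.
  rewrite /= -/(y n) /f cmulZl cmulZr cmulDl cmulDr /a !cmulA.
  by rewrite -[cmul (cmul (y n) (y n)) b]cmulA IH !cmulA IH.
have y2 n : y n.+1 + y n.+1 = a + cmul (y n) (y n).
  by rewrite /= -/(y n) /f -scalerDr half_double.
exists l; split.
- apply/eqP; rewrite -subr_eq0; apply/eqP.
  apply: (@norm_le_eps _ (1 + 1)) => [|e /yl[n [le _]]]; first by rewrite addr_ge0.
  rewrite -(subrKA (y n)) -{1}(ys n) -cstarB mulrDr mulr1.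
  rewrite (le_trans (ler_normD _ _))// lerD//; first by rewrite norm_cstar.
  by rewrite distrC.
- apply/eqP; rewrite -subr_eq0; apply/eqP.
  apply: (@norm_le_eps _ (`|b| + `|b|)) => [|e /yl[n [le _]]]; first exact: addr_ge0.
  rewrite -(subrKA (cmul (y n) b)) {2}yb -cmulBl -cmulBr mulrDr.
  rewrite (le_trans (ler_normD _ _))// lerD// (le_trans (cnormM_le _ _))//.
    by rewrite ler_wpM2r.
  by rewrite mulrC ler_wpM2r// distrC.
apply/eqP; rewrite -subr_eq0; apply/eqP.
(* The part [1 + 1] pays for replacing [l + l], and [r + |l|] for replacing the square of [l] by
   that of [y n]. *)
apply: (@norm_le_eps _ ((1 + 1) + (r + `|l|))) => [|e /yl[n [le le1]]].
  by rewrite !addr_ge0.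
have -> : l + l - cmul l l - cmul b b =
    (l - y n.+1) + (l - y n.+1) + (cmul (y n) (y n) - cmul l l).
  have := y2 n; rewrite -/a; move: (y n.+1) (cmul (y n) (y n)) => u v uv.
  rewrite (addrACA l (- u)) -opprD uv opprD.
  by rewrite [in RHS](addrA (l + l)) [in RHS](addrA _ v) subrK addrAC.
rewrite (le_trans (ler_normD _ _))// [in leRHS]mulrDr lerD//.
  by rewrite (le_trans (ler_normD _ _))// mulrDr mulr1 lerD.
rewrite cmul_sqrB (le_trans (ler_normD _ _))// mulrDr lerD//.
  by rewrite (le_trans (cnormM_le _ _))// mulrC ler_pM// distrC.
by rewrite (le_trans (cnormM_le _ _))// ler_wpM2r// distrC.
Qed.

End CStarBasics.

Section Contractive.
Variable R : realType.

Lemma cstar_cone (B : unitalCStarAlgType R) : cstar (cone : B) = cone.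
Proof.
by rewrite -[LHS]cmul1r -[in X in cmul _ X](cstarK (cone : B)) -cstarM cmul1r cstarK.
Qed.

(** Equality fails in the zero algebra, where [cone = 0]. *)
Lemma norm_cone_le (B : unitalCStarAlgType R) : `|cone : B| <= 1.
Proof.
have := cnorm_starM (cone : B); rewrite cstar_cone cmul1l.
have [->|c0] := eqVneq (cone : B) 0; first by rewrite normr0 ler01.
rewrite expr2 -[X in X = _]mulr1 => /mulfI <-//.
by rewrite normr_eq0.
Qed.

Lemma star_morphism_raddf (A B : cstarAlgType R) (f : A -> B) : star_morphism f ->
  [/\ f 0 = 0, forall x y, f (x + y) = f x + f y, forall x, f (- x) = - f x &
    forall (k : R[i]) x, f (k *: x) = k *: f x].
Proof.
move=> [fl _ _]; have fD x y : f (x + y) = f x + f y.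
  by have := fl 1 x y; rewrite !scale1r.
have f0 : f 0 = 0 by apply: (addrI (f 0)); rewrite -fD !addr0.
have fZ (k : R[i]) x : f (k *: x) = k *: f x.
  by have := fl k x 0; rewrite f0 !addr0.
by split => // x; rewrite -scaleN1r fZ scaleN1r.
Qed.

(* With y from cstar_sqrt, u = f b + i (1 - f y) is unitary and f b is its real part. *)
Lemma star_morphism_unital_le1 (A : cstarAlgType R) (B : unitalCStarAlgType R)
    (f : A -> B) (b : A) :
  star_morphism f -> cstar b = b -> `|b| < 1 -> `|f b| <= 1.
Proof.
move=> fm bs b1; have [f0 fD fN fZ] := star_morphism_raddf fm.
have [_ fM fs] := fm; have [y [ys yb y2]] := cstar_sqrt bs b1.
pose x := f b; pose c := cone - f y.
have xs : cstar x = x by rewrite -fs bs.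
have cs : cstar c = c by rewrite cstarB cstar_cone -fs ys.
have xc : cmul x c = cmul c x.
  by rewrite cmulBl cmulBr cmul1l cmul1r -!fM yb.
have xxcc : cmul x x + cmul c c = cone.
  rewrite -fM -y2 fD fD fN fM /c; move: (f y) => z.
  rewrite cmulBl !cmulBr !cmul1l !cmul1r; move: (cmul z z) => w.
  by rewrite -(addrA cone) -opprD (addrA z z) [LHS]addrC subrK.
pose u := x + 'i *: c.
have us : cstar u = x - 'i *: c by rewrite cstarD cstarZ xs cs conjCi scaleNr.
have u1 : `|u| <= 1.
  have : `|u| ^+ 2 <= 1.
    rewrite -cnorm_starM us (_ : cmul _ _ = cone) ?norm_cone_le//.
    rewrite cmulBl !cmulDr !cmulZl !cmulZr scalerA -expr2 sqrCi scaleN1r xc.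
    by rewrite opprD opprK addrA addrK.
  by rewrite expr_le1.
have -> : f b = (2^-1 : R[i]) *: (u + cstar u).
  by rewrite us addrACA subrr addr0 half_double.
rewrite normrZ ger0_norm ?invr_ge0// ler_pdivrMl// mulr1.
by rewrite (le_trans (ler_normD _ _))// norm_cstar mulr2n lerD.
Qed.

(** The C*-identity allows testing left multiplication by [x] on [cstar x]. Norms in a codomain can
    thus be estimated in its multiplier algebra, which has a unit. *)
Lemma norm_le_mult_of (A : cstarAlgType R) (x : A) : `|x| <= `|mult_of x|.
Proof.
have [->|x0] := eqVneq x 0; first by rewrite normr0.
have xgt0 : 0 < `|x| by rewrite normr_gt0.
rewrite -(ler_pM2r xgt0) -expr2 -cnormM_star -(norm_cstar x).
exact: (mult_norm_ub (mult_of x) (cstar x)).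
Qed.

(** Composing with [mult_of] makes the codomain unital. Self-adjoint elements are scaled to norm
    below [1], and [|f b|^2 = |f (b^* b)| <= |b^* b| = |b|^2] reduces the general case to them. *)
Lemma star_morphism_le (A B : cstarAlgType R) (f : A -> B) : star_morphism f ->
  forall b, `|f b| <= `|b|.
Proof.
move=> fm; pose g b := mult_of (f b).
have gm : star_morphism g.
  have [fl fM fs] := fm; have [ml mM ms] := mult_of_morphism B.
  split => [k x y|x y|x]; rewrite /g.
  - by rewrite fl ml.
  - by rewrite fM mM.
  - by rewrite fs ms.
have [_ _ _ gZ] := star_morphism_raddf gm; have [_ gM gs] := gm.
have self b : cstar b = b -> `|g b| <= `|b|.
  move=> bs; apply/ler_addgt0Pr => e e0.
  (* Adding [e] keeps the divisor positive at [b = 0] and the scaled norm strictly below [1]. *)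
  have be : 0 < `|b| + e by rewrite ltr_wpDl.
  have bei : 0 <= (`|b| + e)^-1 by rewrite invr_ge0 ltW.
  have : `|g ((`|b| + e)^-1 *: b)| <= 1.
    apply: star_morphism_unital_le1 => //.
      by rewrite cstarZ bs; congr (_ *: _); apply: conj_Creal; rewrite ger0_real.
    rewrite normrZ ger0_norm// ltr_pdivrMl// mulr1.
    by rewrite ltrDl.
  by rewrite gZ normrZ ger0_norm// ler_pdivrMl// mulr1.
move=> b; apply: le_trans (norm_le_mult_of _) _; rewrite -/(g b).
rewrite -(@ler_pXn2r _ 2) ?nnegrE// -!cnorm_starM -gs -gM self//.
by rewrite cstarM cstarK.
Qed.

End Contractive.

(** * Algebras of bounded families *)

Section BoundedFamilies.
Variables (R : realType) (I : Type) (A : I -> cstarAlgType R).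

(** The norm-closed star subalgebras of the l^infinity-product of the [A i]; [bss_closed] is closure
    under uniform limits, the source of completeness. *)
Record bounded_star_subalg (S : set (forall i, A i)) : Prop := {
  bss_bound : forall x, S x -> exists k : R[i], forall i, `|x i| <= k ;
  bss0 : S (fun=> 0) ;
  bss_lin : forall (k : R[i]) x y, S x -> S y -> S (fun i => k *: x i + y i) ;
  bss_mul : forall x y, S x -> S y -> S (fun i => cmul (x i) (y i)) ;
  bss_star : forall x, S x -> S (fun i => cstar (x i)) ;
  bss_closed : forall x, (forall e : R[i], 0 < e ->
    exists2 y, S y & forall i, `|x i - y i| <= e) -> S x
}.

Variables (S : set (forall i, A i)) (hS : bounded_star_subalg S).

Record bfam := BFam { bval : forall i, A i ; bvalP : S bval }.

Lemma bfam_eq (x y : bfam) : (forall i, bval x i = bval y i) -> x = y.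
Proof.
case: x y => [x Sx] [y Sy] /= xy.
have {}xy : x = y by exact: functional_extensionality_dep.
by case: _ / xy Sy => Sy; congr BFam; exact: Prop_irrelevance.
Qed.

End BoundedFamilies.

(* The algebra of the families in S: the phantom argument hS carries the
   closure properties on which the instances depend. *)
Definition bfam_alg (R : realType) (I : Type) (A : I -> cstarAlgType R)
  (S : set (forall i, A i)) (hS : bounded_star_subalg S) : Type := bfam S.

Section BoundedFamilyAlgebra.
Variables (R : realType) (I : Type) (A : I -> cstarAlgType R).
Variables (S : set (forall i, A i)) (hS : bounded_star_subalg S).

Local Notation T := (bfam_alg hS).
Implicit Types x y z : T.

HB.instance Definition _ := gen_eqMixin T.
HB.instance Definition _ := gen_choiceMixin T.

Let S_add (x y : forall i, A i) : S x -> S y -> S (fun i => x i + y i).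
Proof.
move=> Sx Sy; have := bss_lin hS 1 Sx Sy; congr S.
by apply: functional_extensionality_dep => i; rewrite scale1r.
Qed.

Let S_scale (k : R[i]) (x : forall i, A i) : S x -> S (fun i => k *: x i).
Proof.
move=> Sx; have := bss_lin hS k Sx (bss0 hS); congr S.
by apply: functional_extensionality_dep => i; rewrite addr0.
Qed.

Let S_opp (x : forall i, A i) : S x -> S (fun i => - x i).
Proof.
move=> Sx; have := S_scale (-1) Sx; congr S.
by apply: functional_extensionality_dep => i; rewrite scaleN1r.
Qed.

Definition bfam_zero : T := BFam (bss0 hS).
Definition bfam_add x y : T := BFam (S_add (bvalP x) (bvalP y)).
Definition bfam_opp x : T := BFam (S_opp (bvalP x)).
Definition bfam_scale (k : R[i]) x : T := BFam (S_scale k (bvalP x)).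
Definition bfam_mul x y : T := BFam (bss_mul hS (bvalP x) (bvalP y)).
Definition bfam_star x : T := BFam (bss_star hS (bvalP x)).

Lemma bfam_addA : associative bfam_add.
Proof. by move=> x y z; apply: bfam_eq => i; exact: addrA. Qed.
Lemma bfam_addC : commutative bfam_add.
Proof. by move=> x y; apply: bfam_eq => i; exact: addrC. Qed.
Lemma bfam_add0 : left_id bfam_zero bfam_add.
Proof. by move=> x; apply: bfam_eq => i; exact: add0r. Qed.
Lemma bfam_addN : left_inverse bfam_zero bfam_opp bfam_add.
Proof. by move=> x; apply: bfam_eq => i; exact: addNr. Qed.

HB.instance Definition _ := GRing.isZmodule.Build T
  bfam_addA bfam_addC bfam_add0 bfam_addN.

Lemma bfam_scaleA k l x : bfam_scale k (bfam_scale l x) = bfam_scale (k * l) x.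
Proof. by apply: bfam_eq => i; exact: scalerA. Qed.
Lemma bfam_scale1 : left_id 1 bfam_scale.
Proof. by move=> x; apply: bfam_eq => i; exact: scale1r. Qed.
Lemma bfam_scaleDr : right_distributive bfam_scale +%R.
Proof. by move=> k x y; apply: bfam_eq => i; exact: scalerDr. Qed.
Lemma bfam_scaleDl x : {morph bfam_scale^~ x : k l / k + l}.
Proof. by move=> k l; apply: bfam_eq => i; exact: scalerDl. Qed.

HB.instance Definition _ := GRing.Zmodule_isLmodule.Build R[i] T
  bfam_scaleA bfam_scale1 bfam_scaleDr bfam_scaleDl.

Definition bfam_norm x : R[i] :=
  (sup [set complex.Re `|bval x i| | i in [set: I]])%:C%C.

Lemma bfam_norm_ub x i : `|bval x i| <= bfam_norm x.
Proof.
have [k xk] := bss_bound hS (bvalP x).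
rewrite -[X in X <= _]RRe_real ?ger0_real// lecR; apply: ub_le_sup; last by exists i.
exists (complex.Re k) => _ [j _ <-].
have := xk j; rewrite lecE => /andP[_].
by [].
Qed.

Lemma bfam_norm_le x (k : R[i]) : 0 <= k -> (forall i, `|bval x i| <= k) ->
  bfam_norm x <= k.
Proof.
move=> k0 xk; rewrite -[k]RRe_real ?ger0_real// lecR.
have [[j]|I0] := pselect (inhabited I).
  apply: ge_sup; first by exists (complex.Re `|bval x j|); exists j.
  by move=> _ [i _ <-]; rewrite -lecR !RRe_real ?ger0_real.
(* For empty [I] the supremum is that of the empty set, [0] by convention, which is the norm of the
   zero algebra. *)
rewrite (_ : [set _ | _ in _] = set0); last first.
  by rewrite -subset0 => r [j]; case: I0.
by rewrite sup0 -lecR RRe_real ?ger0_real.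
Qed.

Lemma bfam_norm_ge0 x : 0 <= bfam_norm x.
Proof.
rewrite lecR; have [[j]|I0] := pselect (inhabited I).
  by rewrite -lecR; exact: le_trans (normr_ge0 _) (bfam_norm_ub x j).
rewrite (_ : [set _ | _ in _] = set0) ?sup0//.
by rewrite -subset0 => r [j]; case: I0.
Qed.

Lemma bfam_normD x y : bfam_norm (x + y) <= bfam_norm x + bfam_norm y.
Proof.
apply: bfam_norm_le; first by rewrite addr_ge0 ?bfam_norm_ge0.
by move=> i; rewrite (le_trans (ler_normD _ _))// lerD ?bfam_norm_ub.
Qed.

Lemma bfam_normZ_le k x : bfam_norm (k *: x) <= `|k| * bfam_norm x.
Proof.
apply: bfam_norm_le; first by rewrite mulr_ge0 ?bfam_norm_ge0.
by move=> i; rewrite [X in `|X|](_ : _ = k *: bval x i)// normrZ ler_wpM2l ?bfam_norm_ub.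
Qed.

Lemma bfam_normZ k x : bfam_norm (k *: x) = `|k| * bfam_norm x.
Proof.
apply/eqP; rewrite eq_le bfam_normZ_le/=.
have [->|k0] := eqVneq k 0; first by rewrite normr0 mul0r bfam_norm_ge0.
rewrite -ler_pdivlMl ?normr_gt0// -normfV.
by have := bfam_normZ_le k^-1 (k *: x); rewrite scalerA mulVf// scale1r.
Qed.

Lemma bfam_norm0 x : bfam_norm x = 0 -> x = 0.
Proof.
move=> x0; apply: bfam_eq => i; apply/eqP.
by have := bfam_norm_ub x i; rewrite x0 normr_le0.
Qed.

HB.instance Definition _ := Lmodule_isNormed.Build R[i] T
  bfam_normD bfam_normZ bfam_norm0.

Lemma bfam_norm_i x i : `|bval x i| <= `|x|. Proof. exact: bfam_norm_ub. Qed.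

(** Coordinates converge in the complete [A i], and the Cauchy estimates are uniform in [i]; the
    limit family is thus a uniform limit of members of [S]. *)
Lemma bfam_complete (F : set_system T) : ProperFilter F -> cauchy F -> cvg F.
Proof.
move=> FF Fc.
have evc i : cvg ((fun x => bval x i) @ F).
  apply: cauchy_cvg; apply/cauchy_exP => e e0.
  have /cauchyP/(_ e e0)[x Fx] := Fc.
  exists (bval x i); rewrite /fmap/=; apply: filterS Fx => y /=.
  rewrite -!ball_normE /ball_/=; apply: le_lt_trans.
  exact: (bfam_norm_i (x - y) i).
pose f i := lim ((fun x => bval x i) @ F).
have fP x (e : R[i]) : 0 < e -> F (ball x e) -> forall i, `|f i - bval x i| <= e.
  move=> e0 Fx i; apply/ler_addgt0Pr => d d0.
  have /cvgrPdist_le/(_ d d0) Fd := evc i.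
  have [y [yd]] := filter_ex (filterI Fd Fx).
  rewrite -ball_normE /ball_/= => xy.
  rewrite -(subrKA (bval y i)) addrC (le_trans (ler_normD _ _))// lerD//.
  by rewrite distrC (le_trans (bfam_norm_i (x - y) i))// ltW.
have Sf : S f.
  apply: (bss_closed hS) => e e0; have /cauchyP/(_ e e0)[x Fx] := Fc.
  by exists (bval x); [exact: bvalP|exact: fP].
apply/cvg_ex; exists (BFam Sf : T); apply/fcvg_ballP => e e0.
have e20 : 0 < e / 2 by rewrite divr_gt0.
have /cauchyP/(_ _ e20)[x Fx] := Fc.
apply: filterS (Fx) => y; rewrite -!ball_normE /ball_/= => xy.
rewrite -(subrKA x) [e]splitr (le_lt_trans (ler_normD _ _))// ler_ltD//.
apply: bfam_norm_le; first exact: ltW.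
by move=> i; exact: fP Fx i.
Qed.

HB.instance Definition _ := Uniform_isComplete.Build T bfam_complete.

Lemma bfam_mulA x y z : bfam_mul x (bfam_mul y z) = bfam_mul (bfam_mul x y) z.
Proof. by apply: bfam_eq => i; exact: cmulA. Qed.
Lemma bfam_mulDl x y z : bfam_mul (x + y) z = bfam_mul x z + bfam_mul y z.
Proof. by apply: bfam_eq => i; exact: cmulDl. Qed.
Lemma bfam_mulDr x y z : bfam_mul x (y + z) = bfam_mul x y + bfam_mul x z.
Proof. by apply: bfam_eq => i; exact: cmulDr. Qed.
Lemma bfam_mulZl k x y : bfam_mul (k *: x) y = k *: bfam_mul x y.
Proof. by apply: bfam_eq => i; exact: cmulZl. Qed.
Lemma bfam_mulZr k x y : bfam_mul x (k *: y) = k *: bfam_mul x y.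
Proof. by apply: bfam_eq => i; exact: cmulZr. Qed.
Lemma bfam_starD x y : bfam_star (x + y) = bfam_star x + bfam_star y.
Proof. by apply: bfam_eq => i; exact: cstarD. Qed.
Lemma bfam_starZ (k : R[i]) x : bfam_star (k *: x) = k^* *: bfam_star x.
Proof. by apply: bfam_eq => i; exact: cstarZ. Qed.
Lemma bfam_starM x y : bfam_star (bfam_mul x y) = bfam_mul (bfam_star y) (bfam_star x).
Proof. by apply: bfam_eq => i; exact: cstarM. Qed.
Lemma bfam_starK x : bfam_star (bfam_star x) = x.
Proof. by apply: bfam_eq => i; exact: cstarK. Qed.

Lemma bfam_normM x y : `|bfam_mul x y| <= `|x| * `|y|.
Proof.
apply: bfam_norm_le; first exact: mulr_ge0.
by move=> i; rewrite (le_trans (cnormM_le _ _))// ler_pM ?bfam_norm_i.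
Qed.

Lemma bfam_norm_starM x : `|bfam_mul (bfam_star x) x| = `|x| ^+ 2.
Proof.
apply/eqP; rewrite eq_le; apply/andP; split.
  apply: bfam_norm_le; first exact: exprn_ge0.
  by move=> i /=; rewrite cnorm_starM lerXn2r ?nnegrE ?bfam_norm_i.
(* By the C*-identity in each [A i], the square root of [s] bounds every coordinate of [x], hence
   the supremum. *)
set s := `|bfam_mul _ _|; have s0 : 0 <= s by exact: normr_ge0.
rewrite -[leRHS]sqrtCK lerXn2r ?nnegrE ?sqrtC_ge0//.
apply: bfam_norm_le; rewrite ?sqrtC_ge0// => i.
rewrite -(@ler_pXn2r _ 2) ?nnegrE ?sqrtC_ge0// sqrtCK -cnorm_starM.
exact: (bfam_norm_i (bfam_mul (bfam_star x) x) i).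
Qed.

HB.instance Definition _ := isCStarAlgebra.Build R T
  bfam_mulA bfam_mulDl bfam_mulDr bfam_mulZl bfam_mulZr bfam_starD bfam_starZ
  bfam_starM bfam_starK bfam_normM bfam_norm_starM.

End BoundedFamilyAlgebra.

Section UnitalBoundedFamilies.
Variables (R : realType) (I : Type) (A : I -> unitalCStarAlgType R).
Variables (S : set (forall i, A i)) (hS : @bounded_star_subalg R I A S).
Hypothesis S1 : S (fun i => cone).

(** The discarded [let] makes [S1] a phantom argument, so that the unit can be attached to the
    type. *)
Definition ubfam_alg : Type := let _ := S1 in bfam_alg hS.

HB.instance Definition _ := CStarAlgebra.on ubfam_alg.

Definition bfam_one : ubfam_alg := BFam S1.

Lemma bfam_mul1l (x : ubfam_alg) : cmul bfam_one x = x.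
Proof. by apply: bfam_eq => i; exact: cmul1l. Qed.
Lemma bfam_mul1r (x : ubfam_alg) : cmul x bfam_one = x.
Proof. by apply: bfam_eq => i; exact: cmul1r. Qed.

HB.instance Definition _ := isUnitalCStarAlgebra.Build R ubfam_alg
  bfam_mul1l bfam_mul1r.

End UnitalBoundedFamilies.

(** * The complex numbers as a C*-algebra *)

Section ComplexNumbers.
Variable R : realType.

(* A copy of R[i] that carries none of its canonical topological structures:
   they are rebuilt from the norm, as for the other C*-algebras. *)
Definition cplx : Type := R[i].

HB.instance Definition _ := GRing.Lmodule.copy cplx R[i]^o.

Let cnorm (x : cplx) : R[i] := `|x : R[i]|.

Let cnormD x y : cnorm (x + y) <= cnorm x + cnorm y.
Proof. exact: ler_normD. Qed.
Let cnormZ (k : R[i]) x : cnorm (k *: x) = `|k| * cnorm x.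
Proof. exact: normrM. Qed.
Let cnorm0 x : cnorm x = 0 -> x = 0.
Proof. exact: normr0_eq0. Qed.

HB.instance Definition _ := Lmodule_isNormed.Build R[i] cplx cnormD cnormZ cnorm0.

Lemma cplx_normE (x : cplx) : `|x| = `|x : R[i]|. Proof. by []. Qed.

Lemma norm_Re_le (x : R[i]) : `|complex.Re x|%:C%C <= `|x|.
Proof. exact: normc_ge_Re. Qed.

Lemma norm_Im_le (x : R[i]) : `|complex.Im x|%:C%C <= `|x|.
Proof.
rewrite normc_def lecR -sqrtr_sqr ler_wsqrtr// lerDr.
exact: sqr_ge0.
Qed.

Lemma norm_le_Re_Im (x : R[i]) :
  `|x| <= (`|complex.Re x| + `|complex.Im x|)%:C%C.
Proof.
case: x => a b; rewrite normc_def lecR /=.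
have ab0 : 0 <= `|a| + `|b| by exact: addr_ge0.
rewrite -[leRHS](ger0_norm ab0) -sqrtr_sqr ler_wsqrtr//.
rewrite sqrrD !real_normK ?num_real// addrAC lerDl.
by rewrite mulrn_wge0// mulr_ge0.
Qed.

Lemma cplx_complete (F : set_system cplx) : ProperFilter F -> cauchy F -> cvg F.
Proof.
move=> FF Fc.
(* Real and imaginary parts are additive and contractive, so completeness of [R] supplies both
   limits. *)
have cvg_part (p : R[i] -> R) : (forall x y, p (x - y) = p x - p y) ->
    (forall x, `|p x|%:C%C <= `|x|) -> cvg (p @ F).
  move=> pB pn; apply: cauchy_cvg; apply/cauchy_exP => e e0.
  have e0' : 0 < e%:C%C by rewrite ltcR.
  have /cauchyP/(_ _ e0')[x Fx] := Fc.
  exists (p x); rewrite /fmap/=; apply: filterS Fx => y /=.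
  rewrite -!ball_normE /ball_/= => xy.
  by rewrite -ltcR -pB (le_lt_trans (pn _)).
have cRe : cvg (@complex.Re R @ F).
  by apply: cvg_part; [case=> [a b] [c d]|exact: norm_Re_le].
have cIm : cvg (@complex.Im R @ F).
  by apply: cvg_part; [case=> [a b] [c d]|exact: norm_Im_le].
apply/cvg_ex; exists (Complex (lim (@complex.Re R @ F)) (lim (@complex.Im R @ F)) : cplx).
apply/fcvg_ballP => _ /complex_gt0_real[e e0 ->].
have e20 : 0 < e / 2 by rewrite divr_gt0.
have /cvgrPdist_lt/(_ _ e20) F1 := cRe; have /cvgrPdist_lt/(_ _ e20) F2 := cIm.
apply: filterS2 F1 F2 => -[a b] /= ea eb.
rewrite -ball_normE /ball_/= (le_lt_trans (norm_le_Re_Im _))// ltcR /= [e]splitr.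
exact: ltrD.
Qed.

HB.instance Definition _ := Uniform_isComplete.Build cplx cplx_complete.

Let cplx_mul (x y : cplx) : cplx := (x : R[i]) * (y : R[i]).
Let cplx_star (x : cplx) : cplx := (x : R[i])^*.

Let mA x y z : cplx_mul x (cplx_mul y z) = cplx_mul (cplx_mul x y) z.
Proof. exact: mulrA. Qed.
Let mDl x y z : cplx_mul (x + y) z = cplx_mul x z + cplx_mul y z.
Proof. exact: mulrDl. Qed.
Let mDr x y z : cplx_mul x (y + z) = cplx_mul x y + cplx_mul x z.
Proof. exact: mulrDr. Qed.
Let mZl (k : R[i]) x y : cplx_mul (k *: x) y = k *: cplx_mul x y.
Proof. exact: (esym (mulrA _ _ _)). Qed.
Let mZr (k : R[i]) x y : cplx_mul x (k *: y) = k *: cplx_mul x y.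
Proof. exact: mulrCA. Qed.
Let sD x y : cplx_star (x + y) = cplx_star x + cplx_star y.
Proof. exact: rmorphD. Qed.
Let sZ (k : R[i]) x : cplx_star (k *: x) = k^* *: cplx_star x.
Proof. exact: rmorphM. Qed.
Let sM x y : cplx_star (cplx_mul x y) = cplx_mul (cplx_star y) (cplx_star x).
Proof. by rewrite /cplx_star rmorphM mulrC. Qed.
Let sK x : cplx_star (cplx_star x) = x. Proof. exact: conjCK. Qed.
Let nM x y : `|cplx_mul x y| <= `|x| * `|y|.
Proof. by rewrite !cplx_normE normrM. Qed.
Let nsM x : `|cplx_mul (cplx_star x) x| = `|x| ^+ 2.
Proof. by rewrite !cplx_normE normrM norm_conjC. Qed.

HB.instance Definition _ := isCStarAlgebra.Build R cplx
  mA mDl mDr mZl mZr sD sZ sM sK nM nsM.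

Definition cplx_one : cplx := (1 : R[i]).
Let m1l (x : cplx) : cmul cplx_one x = x. Proof. exact: mul1r. Qed.
Let m1r (x : cplx) : cmul x cplx_one = x. Proof. exact: mulr1. Qed.

HB.instance Definition _ := isUnitalCStarAlgebra.Build R cplx m1l m1r.

End ComplexNumbers.

(** * Actions on algebras of bounded families *)

Section FamilyActions.
Variables (R : realType) (G : topologicalGroupType) (I : Type).
Variable A : I -> cstarAlgType R.
Implicit Types x y : forall i, A i.

Definition bounded_fam : set (forall i, A i) :=
  [set x | exists2 k : R[i], 0 <= k & forall i, `|x i| <= k].

Lemma bounded_fam0 : bounded_fam (fun=> 0).
Proof. by exists 0 => // i; rewrite normr0. Qed.

Lemma bounded_fam_lin (k : R[i]) x y : bounded_fam x -> bounded_fam y ->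
  bounded_fam (fun i => k *: x i + y i).
Proof.
move=> [a a0 xa] [b b0 yb]; exists (`|k| * a + b) => [|i].
  by rewrite addr_ge0 ?mulr_ge0.
rewrite (le_trans (ler_normD _ _))// lerD//.
by rewrite normrZ ler_wpM2l ?xa.
Qed.

Lemma bounded_fam_mul x y : bounded_fam x -> bounded_fam y ->
  bounded_fam (fun i => cmul (x i) (y i)).
Proof.
move=> [a a0 xa] [b b0 yb]; exists (a * b) => [|i]; first by rewrite mulr_ge0.
by rewrite (le_trans (cnormM_le _ _))// ler_pM ?xa ?yb.
Qed.

Lemma bounded_fam_star x : bounded_fam x -> bounded_fam (fun i => cstar (x i)).
Proof. by move=> [a a0 xa]; exists a => // i; rewrite norm_cstar. Qed.

Lemma bounded_fam_closed x : (forall e : R[i], 0 < e ->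
  exists2 y, bounded_fam y & forall i, `|x i - y i| <= e) -> bounded_fam x.
Proof.
move=> /(_ 1 ltr01)[y [a a0 ya] xy]; exists (1 + a) => [|i]; first by rewrite addr_ge0.
by rewrite -(subrK (y i) (x i)) (le_trans (ler_normD _ _))// lerD.
Qed.

Lemma bounded_fam_subalg : bounded_star_subalg bounded_fam.
Proof.
split.
- by move=> x [k _ xk]; exists k.
- exact: bounded_fam0.
- exact: bounded_fam_lin.
- exact: bounded_fam_mul.
- exact: bounded_fam_star.
- exact: bounded_fam_closed.
Qed.

(* G may act on the values, on the indices, or on both. *)
Record family_action (tact : G -> (forall i, A i) -> forall i, A i) : Prop := {
  fa_action : is_action tact ;
  fa_lin : forall g (k : R[i]) x y,
    tact g (fun i => k *: x i + y i) = fun i => k *: tact g x i + tact g y i ;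
  fa_mul : forall g x y,
    tact g (fun i => cmul (x i) (y i)) = fun i => cmul (tact g x i) (tact g y i) ;
  fa_star : forall g x,
    tact g (fun i => cstar (x i)) = fun i => cstar (tact g x i) ;
  fa_le : forall g x (k : R[i]), (forall i, `|x i| <= k) ->
    forall i, `|tact g x i| <= k
}.

Variable tact : G -> (forall i, A i) -> forall i, A i.
Hypothesis tactP : family_action tact.

(** Continuity at [1] of the orbit of [x] in the sup norm, put in coordinates because [x] is not yet
    an element of a normed algebra. *)
Definition orbit_equicontinuous x : Prop := forall e : R[i], 0 < e ->
  \forall g \near (1%g : G), forall i, `|tact g x i - x i| <= e.

Lemma fa_sub g x y i : tact g (fun j => x j - y j) i = tact g x i - tact g y i.
Proof.
have := fa_lin tactP g (-1) y x => /(congr1 (fun f => f i)).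
rewrite scaleN1r addrC => <-; congr (tact g _ i).
by apply: functional_extensionality_dep => j; rewrite scaleN1r addrC.
Qed.

Lemma bounded_fam_act g x : bounded_fam x -> bounded_fam (tact g x).
Proof. by move=> [k k0 xk]; exists k => //; exact: fa_le. Qed.

(** [tact g x - tact g0 x] is the image under the contractive [tact g0] of the displacement of [x]
    by [g0^-1 g]. *)
Lemma orbit_equicontinuous_at x g0 (e : R[i]) : orbit_equicontinuous x -> 0 < e ->
  \forall g \near g0, forall i, `|tact g x i - tact g0 x i| <= e.
Proof.
move=> xe e0; have [tact1 tactM] := fa_action tactP.
have : (fun g => g0^-1 * g)%g @ g0 --> (1%g : G).
  by rewrite -[X in _ --> X](mulVg g0); exact: lmulg_continuous.
move=> /(_ _ (xe e e0)).
apply: (@filterS _ (nbhs g0)) => g /= ge i.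
rewrite -[in tact g x](mulVKg g0 g) tactM -fa_sub.
exact: fa_le.
Qed.

Definition equicontinuous_fam : set (forall i, A i) :=
  [set x | bounded_fam x /\ orbit_equicontinuous x].

(** Since [h g = g (g^-1 h g)], displacing [tact g x] by [h] amounts to displacing [x] by a
    conjugate of [h] and then applying [tact g]. *)
Lemma equicontinuous_fam_act g x :
  equicontinuous_fam x -> equicontinuous_fam (tact g x).
Proof.
move=> [bx xe]; split; first exact: bounded_fam_act.
move=> e e0; have [tact1 tactM] := fa_action tactP.
have : (fun h => g^-1 * h * g)%g @ (1%g : G) --> (1%g : G).
  rewrite -[X in _ --> X](mulVg g) -[X in (X * _)%g](mulg1 g^-1%g).
  by apply: cvg_mulg; [apply: cvg_mulg; [exact: cvg_cst|exact: cvg_id]|exact: cvg_cst].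
move=> /(_ _ (xe e e0)); apply: (@filterS _ (nbhs (1%g : G))) => h /= he i.
rewrite (_ : tact h (tact g x) = tact g (tact (g^-1 * h * g)%g x)).
  by rewrite -fa_sub; exact: fa_le.
by rewrite -!tactM !mulgA mulgV mul1g.
Qed.

Lemma equicontinuous_fam_subalg : bounded_star_subalg equicontinuous_fam.
Proof.
have [tact1 tactM] := fa_action tactP.
split.
- by move=> x [[k _ xk] _]; exists k.
- split; first exact: bounded_fam0.
  move=> e e0; apply: nearW => g i; rewrite subr0 (le_trans _ (ltW e0))//.
  by apply: (fa_le tactP) => j; rewrite normr0.
- move=> k x y [bx xe] [b_y ye]; split; first exact: bounded_fam_lin.
  move=> e e0; have k1 : 0 < `|k| + 1 by rewrite ltr_wpDl.
  apply: (@filterS2 _ (nbhs (1%g : G)) _ _ _ _ _ (xe _ (divr_gt0 e0 k1))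
    (ye _ (divr_gt0 e0 k1))) => g gx gy i.
  rewrite (fa_lin tactP) opprD addrACA -scalerBr (le_trans (ler_normD _ _))//.
  rewrite normrZ (le_trans (lerD (ler_wpM2l _ (gx i)) (gy i)))//.
  by rewrite -[X in _ + X]mul1r -mulrDl mulrCA mulfV ?mulr1// gt_eqF.
- move=> x y [[a a0 xa] xe] [[b b0 yb] ye]; split.
    by apply: bounded_fam_mul; [exists a|exists b].
  (* In the denominator, [a] bounds the translate of [x], [b] bounds [y], and [1] ensures
     positivity. *)
  move=> e e0; have k1 : 0 < a + b + 1 by rewrite ltr_wpDl// addr_ge0.
  apply: (@filterS2 _ (nbhs (1%g : G)) _ _ _ _ _ (xe _ (divr_gt0 e0 k1))
    (ye _ (divr_gt0 e0 k1))) => g gx gy i.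
  rewrite (fa_mul tactP) -(subrKA (cmul (tact g x i) (y i))) -cmulBr -cmulBl.
  have e'0 : 0 <= e / (a + b + 1) by rewrite divr_ge0// ltW.
  rewrite (le_trans (ler_normD _ _))//.
  rewrite (le_trans (lerD (cnormM_le _ _) (cnormM_le _ _)))//.
  rewrite (@le_trans _ _ (a * (e / (a + b + 1)) + (e / (a + b + 1)) * b))//.
    by rewrite lerD// ler_pM ?gx ?gy ?yb//; apply: (fa_le tactP).
  rewrite [X in _ + X]mulrC -mulrDl mulrCA ler_piMr// ?(ltW e0)//.
  by rewrite ler_pdivrMr// mul1r lerDl.
- move=> x [bx xe]; split; first exact: bounded_fam_star.
  move=> e /xe; apply: (@filterS _ (nbhs (1%g : G))) => g gx i.
  by rewrite (fa_star tactP) -cstarB norm_cstar.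
- move=> x xy; split.
    apply: bounded_fam_closed => e e0; have [y [b_y _] ye] := xy e e0.
    by exists y.
  (* One third for the displacement of [y], and one for replacing [x] by [y] on each side of the
     translation. *)
  move=> e e0; have e30 : 0 < e / 3 by rewrite divr_gt0.
  have [y [_ ye] xye] := xy _ e30.
  have := ye _ e30; apply: (@filterS _ (nbhs (1%g : G))) => g gy i.
  have -> : tact g x i - x i =
      (tact g x i - tact g y i) + (tact g y i - y i) + (y i - x i).
    by rewrite subrKA subrKA.
  have -> : e = e / 3 + e / 3 + e / 3.
    by rewrite -[LHS](@divfK _ 3%:R) ?pnatr_eq0// mulr_natr !mulrSr mulr0n add0r.
  rewrite (le_trans (ler_normD _ _))// lerD//; last by rewrite distrC.
  rewrite (le_trans (ler_normD _ _))// lerD// -fa_sub.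
  exact: (fa_le tactP).
Qed.

Section Action.
Variables (S : set (forall i, A i)) (hS : bounded_star_subalg S).
Hypothesis S_act : forall g x, S x -> S (tact g x).
Hypothesis S_equi : forall x, S x -> orbit_equicontinuous x.

Definition bfam_act (g : G) (x : bfam_alg hS) : bfam_alg hS :=
  BFam (S_act g (bvalP x)).

Lemma bfam_act_continuous : continuous_cstar_action bfam_act.
Proof.
have [tact1 tactM] := fa_action tactP.
split.
- split=> [x|g h x]; apply: bfam_eq => i /=; first by rewrite tact1.
  by rewrite tactM.
- move=> g; split => [k x y|x y|x]; apply: bfam_eq => i.
  + by have := fa_lin tactP g k (bval x) (bval y) => /(congr1 (fun f => f i)).
  + by have := fa_mul tactP g (bval x) (bval y) => /(congr1 (fun f => f i)).
  + by have := fa_star tactP g (bval x) => /(congr1 (fun f => f i)).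
move=> x g0; apply/cvgrPdist_le => e e0.
have := orbit_equicontinuous_at g0 (S_equi (bvalP x)) e0.
apply: (@filterS _ (nbhs g0)) => g gP.
apply: bfam_norm_le; first exact: ltW.
by move=> i; have := gP i; rewrite distrC.
Qed.

End Action.

End FamilyActions.

Section FamilyActionExamples.
Variables (R : realType) (G : topologicalGroupType) (I : Type).

Lemma pointwise_family_action (A : I -> cstarAlgType R)
    (act : forall i, G -> A i -> A i) :
  (forall i, is_action (act i)) -> (forall i g, star_morphism (act i g)) ->
  family_action (fun g x i => act i g (x i)).
Proof.
move=> actP actm; split.
- split=> [x|g h x]; apply: functional_extensionality_dep => i.
    by have [-> _] := actP i.
  by have [_ ->] := actP i.
- move=> g k x y; apply: functional_extensionality_dep => i.
  by have [l _ _] := actm i g; rewrite l.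
- move=> g x y; apply: functional_extensionality_dep => i.
  by have [_ l _] := actm i g; rewrite l.
- move=> g x; apply: functional_extensionality_dep => i.
  by have [_ _ l] := actm i g; rewrite l.
- by move=> g x k xk i; rewrite (le_trans (star_morphism_le (actm i g) _)).
Qed.

Lemma translation_family_action (A : cstarAlgType R) (act : G -> I -> I) :
  is_action act ->
  @family_action R G I (fun=> A) (fun g x i => x (act g^-1%g i)).
Proof.
move=> [act1 actM]; split => //.
split=> [x|g h x]; apply/funext => i.
  by rewrite invg1 act1.
by rewrite invgM actM.
Qed.

End FamilyActionExamples.

(** * Multiplier algebras and products *)

Section CStarDiscrete.
Variables (R : realType) (G : topologicalGroupType).
Hypothesis oG : forall U : set G, open U.

Lemma discrete_cstar_action (A : cstarAlgType R) (act : G -> A -> A) :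
  is_action act -> (forall g, star_morphism (act g)) -> continuous_cstar_action act.
Proof.
move=> actP actm; split => // a g U /= Ug.
apply: (@filterS _ (nbhs g) _ _ _ _ (near_discrete oG g)) => h ->.
exact: nbhs_singleton Ug.
Qed.

Section Multipliers.
Variables (A : cstarAlgType R) (act : G -> A -> A).
Hypothesis actP : continuous_cstar_action act.

Let act_m g : star_morphism (act g). Proof. by case: actP. Qed.
Let actK g a : act g (act g^-1%g a) = a.
Proof. by case: actP => -[act1 actM] _ _; rewrite -actM mulgV act1. Qed.

Lemma mult_act_subproof g (T : multiplier A) :
  ((fun a => act g ((mval T).1 (act g^-1%g a))),
   (fun a => act g ((mval T).2 (act g^-1%g a)))) \in @is_double_centralizer R A.
Proof.
have [Tl Tr Tbl Tbr TL TR TLR] := multP T.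
have [gl gM gs] := act_m g; have [hl hM hs] := act_m g^-1%g.
have lin (f : A -> A) : linear f -> linear (fun a => act g (f (act g^-1%g a))).
  by move=> fl k a b; rewrite hl fl gl.
have bnd (f : A -> A) : (exists k : R[i], forall a, `|f a| <= k * `|a|) ->
    exists k : R[i], forall a, `|act g (f (act g^-1%g a))| <= k * `|a|.
  move=> /dc_bound_ge0[k k0 fk]; exists k => a.
  rewrite (le_trans (star_morphism_le (act_m g) _))// (le_trans (fk _))//.
  by rewrite ler_wpM2l// (star_morphism_le (act_m _)).
apply/asboolP; split => /=; [exact: lin|exact: lin|exact: bnd|exact: bnd| | |].
- by move=> a b; rewrite hM TL gM actK.
- by move=> a b; rewrite hM TR gM actK.
- by move=> a b; rewrite -{1}(actK g a) -gM TLR gM actK.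
Qed.

Definition mult_act g (T : multiplier A) : multiplier A :=
  Multiplier (mult_act_subproof g T).

Lemma mult_act_continuous : continuous_cstar_action mult_act.
Proof.
have [[act1 actM] _ _] := actP.
have actVK g a : act g^-1%g (act g a) = a by rewrite -actM mulVg act1.
apply: discrete_cstar_action.
  split=> [T|g h T]; apply: mult_eq => a /=; first by rewrite invg1 !act1.
  by rewrite invgM !actM.
move=> g; have [gl gM gs] := act_m g; have [hl hM hs] := act_m g^-1%g.
split.
- by move=> k S T; apply: mult_eq => a; exact: gl.
- by move=> S T; apply: mult_eq => a /=; rewrite actVK.
- by move=> T; apply: mult_eq => a /=; rewrite hs gs.
Qed.

Lemma mult_act_equivariant : equivariant act mult_act (@mult_of R A).
Proof.
move=> g a; apply: mult_eq => b /=; have [_ gM _] := act_m g.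
by rewrite gM actK.
Qed.

End Multipliers.

(** Discreteness makes the coordinatewise action on the l^infinity-product [L] continuous, so its
    projections induce [h : L -> P]. Morphisms [f i], equivariant or not, combine into a map to [L]
    followed by [h]. As [h] has the section given by [pi], a map into [P] is determined by its
    composites with [pi]. *)
Lemma discrete_preserves_products : preserves_products (forget_ucstar R G).
Proof.
move=> I A P pi piP B f.
have bs := @bounded_fam_subalg R I A.
have b1 : @bounded_fam R I A (fun i => cone).
  by exists 1 => // i; exact: norm_cone_le.
pose L : unitalCStarAlgType R := ubfam_alg bs b1.
have actA i : is_action (@uca_act R G (A i)) by case: (uca_actP (A i)).
have actm i g : star_morphism (@uca_act R G (A i) g) by case: (uca_actP (A i)).
have fa := pointwise_family_action actA actm.
have orb (x : forall i, A i) : bounded_fam x ->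
    orbit_equicontinuous (fun g (x : forall i, A i) i => uca_act g (x i)) x.
  move=> bx e e0; apply: (@filterS _ (nbhs (1%g : G)) _ _ _ _ (near_discrete oG 1%g)).
  move=> g -> i; have [-> _] := actA i.
  by rewrite subrr normr0 ltW.
have actL := @bfam_act_continuous R G I A _ fa _ bs (bounded_fam_act fa) orb.
pose LA : ucstarAct R G := @UCStarAct R G L _ actL.
have bfamP (C : unitalCStarAlgType R) (k : forall i, C -> A i) c :
    (forall i, star_morphism (k i)) -> @bounded_fam R I A (fun i => k i c).
  by move=> km; exists `|c| => // i; exact: star_morphism_le.
pose fam (C : unitalCStarAlgType R) (k : forall i, C -> A i)
    (km : forall i, star_morphism (k i)) (c : C) : L := BFam (bfamP C k c km).
have famP (C : unitalCStarAlgType R) (k : forall i, C -> A i) km :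
    (forall i, k i cone = cone) -> unital_star_morphism (@fam C k km).
  move=> k1; split; last by apply: bfam_eq => i; exact: k1.
  by split => [a x y|x y|x]; apply: bfam_eq => i; have [l m s] := km i;
    [exact: l|exact: m|exact: s].
have projP i : @ucstarAct_mor R G LA (A i) (fun x => bval x i).
  by split => //; split.
have [h [hpi hU]] := piP LA (fun i => exist _ _ (projP i)).
have fm i : star_morphism (sval (f i)) by exact: (svalP (f i)).1.
have f1 i : sval (f i) cone = cone by exact: (svalP (f i)).2.
have pim i : star_morphism (sval (pi i)) by exact: (svalP (pi i)).1.1.
have pi1 i : sval (pi i) cone = cone by exact: (svalP (pi i)).1.2.
have hfam (C : unitalCStarAlgType R) (k : forall i, C -> A i) km c i :
    sval (pi i) (sval h (@fam C k km c)) = k i c.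
  by have /(congr1 sval)/(congr1 (fun g => g (fam C k km c))) := hpi i.
have hm : unital_star_morphism (sval h) := (svalP h).1.
have hpiK p : sval h (fam P (fun i => sval (pi i)) pim p) = p.
  have [u [_ uU]] := piP P pi.
  have e1 : u = @idm (ucstarAct_cat R G) P by apply: uU => i; exact: compm_idr.
  (* w is a section of h, by uniqueness of the morphism P -> P over pi. *)
  pose w : P -> LA := fam P (fun i => sval (pi i)) pim.
  have wP : @ucstarAct_mor R G P LA w.
    split; first exact: famP.
    by move=> g p'; apply: bfam_eq => i; exact: (svalP (pi i)).2.
  have e2 : u = @compm (ucstarAct_cat R G) P LA P h (exist _ w wP).
    by apply: uU => i; apply: sval_inj; apply/funext => p' /=; rewrite hfam.
  by move: e2; rewrite e1 => /(congr1 sval)/(congr1 (fun g => g p)).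
pose k : B -> P := sval h \o fam B (fun i => sval (f i)) fm.
have kP : unital_star_morphism k.
  have [[hl hM hs] h1] := hm; have [[wl wM ws] w1] := famP B _ fm f1.
  split; last by rewrite /k /= w1.
  by split => [a x y|x y|x]; rewrite /k /= ?wl ?hl ?wM ?hM ?ws ?hs.
exists (exist _ k kP); split.
  by move=> i; apply: sval_inj; apply/funext => b /=; rewrite hfam.
move=> k' kf; apply: sval_inj; apply/funext => b /=.
rewrite -[RHS]hpiK; congr (sval h _); apply: bfam_eq => i /=.
by have /(congr1 sval)/(congr1 (fun g => g b)) := kf i.
Qed.

End CStarDiscrete.

(** A star morphism need not be unital, but [act g] is surjective, so [act g cone] is a unit and
    equals [cone]. *)
Lemma cstar_action_cone (R : realType) (G : topologicalGroupType)
    (A : unitalCStarAlgType R) (act : G -> A -> A) (g : G) :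
  continuous_cstar_action act -> act g cone = cone.
Proof.
move=> [[act1 actM] actm _]; have [_ gM _] := actm g.
have actK a : act g (act g^-1%g a) = a by rewrite -actM mulgV act1.
by rewrite -[LHS]cmul1r -{2}(actK cone) -gM cmul1l actK.
Qed.

(** * Displaced elements of a C*-algebra; preservation of products forces discreteness *)

Section CStarDisplacement.
Variables (R : realType) (G : topologicalGroupType).
Hypotheses (hausG : hausdorff_space G) (lcG : locally_compact [set: G]).

(** The algebra consists of the bounded complex functions on [opG] with norm-continuous translation
    orbits. It contains each [F g], which is continuous on a compact space with a continuous
    action. *)
Lemma displacing_cstar_action : exists (A : unitalCStarAlgType R)
    (act : G -> A -> A) (x : G -> A),
  [/\ continuous_cstar_action act, forall g, `|x g| <= 1 &
    forall g, g != 1%g -> 1 <= `|act g (x g) - x g|].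
Proof.
have [F [cF F01 Fg]] := @displacing_functions R G hausG lcG.
have actO := opc_act_continuous hausG lcG.
have [[act1 actM] cact] := actO.
pose opG := one_point_compactification G.
have fa := @translation_family_action R G opG (cplx R) _ (continuous_action_action actO).
pose hS := equicontinuous_fam_subalg fa.
have S1 : @equicontinuous_fam R G opG (fun=> cplx R)
    (fun g x i => x (opc_act g^-1%g i)) (fun i => cone).
  split; first by exists 1 => // i; exact: norm_cone_le.
  by move=> e e0; apply: nearW => g i; rewrite subrr normr0 ltW.
pose A : unitalCStarAlgType R := ubfam_alg hS S1.
have actA := @bfam_act_continuous R G opG _ _ fa _ hS (equicontinuous_fam_act fa)
  (fun x => @proj2 _ _).
have FS g : @equicontinuous_fam R G opG (fun=> cplx R)
    (fun g x i => x (opc_act g^-1%g i)) (fun i => (F g i)%:C%C : cplx R).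
  split.
    exists 1 => // i; rewrite cplx_normE ger0_norm ?lecR; last by case/andP: (F01 g i).
    by case/andP: (F01 g i).
  move=> _ /complex_gt0_real[e e0 ->].
  have := action_equicontinuous one_point_compactification_compact actO (cF g) e0.
  (* Functions are translated through [g^-1], so the neighbourhood is pulled back along
     inversion. *)
  have : (fun h => h^-1)%g @ (1%g : G) --> (1%g : G).
    by rewrite -[X in _ --> X]invg1; exact: invg_continuous.
  move=> /[apply]; apply: (@filterS _ (nbhs (1%g : G))) => h /= he i.
  rewrite cplx_normE -rmorphB /= normc_def /= expr0n /= addr0 sqrtr_sqr lecR.
  exact: ltW.
pose x g : A := BFam (FS g).
exists A, (bfam_act (equicontinuous_fam_act fa)), x; split=> //.
  move=> g; apply: bfam_norm_le => // i.
  rewrite /= cplx_normE ger0_norm ?lecR; last by case/andP: (F01 g i).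
  by case/andP: (F01 g i).
move=> g g1.
(* At the point [g] the translate takes the value of [F g] at [1]. *)
apply: le_trans (bfam_norm_i (bfam_act (equicontinuous_fam_act fa) g (x g) - x g)
  (Some g)).
rewrite /= cplx_normE -rmorphB /= mulVg normc_def /= expr0n /= addr0 sqrtr_sqr.
have := Fg g g1; rewrite /= mulg1 distrC => ->.
by [].
Qed.

(** With actions, the product of [G]-many copies of [A] is the algebra of bounded equicontinuous
    families. If it is also the product without actions, the full l^infinity-product maps into it
    over the projections, so the bounded family [x] is equicontinuous. *)
Lemma products_discrete : preserves_products (forget_ucstar R G) ->
  forall U : set G, open U.
Proof.
move=> pres; have [A [act [x [actP x1 xg]]]] := displacing_cstar_action.
have [[act1 actM] actm cact] := actP.
have fa := @pointwise_family_action R G G (fun=> A) (fun=> act)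
  (fun=> cstar_action_action actP) (fun=> cstar_action_morphism actP).
pose hS := equicontinuous_fam_subalg fa.
have b1 : @bounded_fam R G (fun=> A) (fun=> cone).
  by exists 1 => // i; exact: norm_cone_le.
have S1 : @equicontinuous_fam R G G (fun=> A) (fun g x i => act g (x i)) (fun=> cone).
  split=> // e e0; apply: nearW => g i.
  by rewrite (cstar_action_cone g actP) subrr normr0 ltW.
pose P : unitalCStarAlgType R := ubfam_alg hS S1.
have actPP := @bfam_act_continuous R G G _ _ fa _ hS (equicontinuous_fam_act fa)
  (fun x => @proj2 _ _).
pose PA : ucstarAct_cat R G := @UCStarAct R G P _ actPP.
pose AA : ucstarAct_cat R G := @UCStarAct R G A _ actP.
have projP i : @ucstarAct_mor R G PA AA (fun y => bval y i) by split => //; split.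
pose pi (i : G) : Defs.hom PA AA := exist _ _ (projP i).
have prod : is_product pi.
  move=> B f.
  have fm i : star_morphism (sval (f i)) by exact: (svalP (f i)).1.1.
  have fS (b : B) : @equicontinuous_fam R G G (fun=> A) (fun g x i => act g (x i))
      (fun i => sval (f i) b).
    split; first by exists `|b| => // i; exact: star_morphism_le.
    move=> e e0; have [[B1 _] _ cB] := @uca_actP R G B.
    have /cvgrPdist_le/(_ e e0) := cB b 1%g.
    apply: (@filterS _ (nbhs (1%g : G))) => g; rewrite B1 distrC => gb i.
    have [_ fD fN _] := star_morphism_raddf (fm i).
    have := (svalP (f i)).2 g b; rewrite /= => <-.
    by rewrite -fN -fD (le_trans (star_morphism_le (fm i) _)).
  pose k (b : B) : P := BFam (fS b).
  have kP : @ucstarAct_mor R G B PA k.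
    split; last by move=> g b; apply: bfam_eq => i; exact: (svalP (f i)).2.
    split; last by apply: bfam_eq => i; exact: (svalP (f i)).1.2.
    by split=> [a y z|y z|y]; apply: bfam_eq => i; have [l m s] := fm i;
      [exact: l|exact: m|exact: s].
  exists (exist _ k kP); split.
    by move=> i; apply: sval_inj; apply/funext.
  move=> k' kf; apply: sval_inj; apply/funext => b; apply: bfam_eq => i.
  by have /(congr1 sval)/(congr1 (fun g => g b)) := kf i.
pose L : unitalCStarAlgType R := ubfam_alg (@bounded_fam_subalg R G (fun=> A)) b1.
have LprojP i : @unital_star_morphism R L A (fun y => bval y i) by split => //; split.
have [h [hpi _]] := pres _ _ _ _ prod L (fun i => exist _ _ (LprojP i)).
have bx : @bounded_fam R G (fun=> A) x by exists 1.
pose y : P := sval h (BFam bx : L).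
have yx i : bval y i = x i.
  by have /(congr1 sval)/(congr1 (fun g => g (BFam bx : L))) := hpi i.
apply: discrete_group.
have h0 : 0 < 2^-1 :> R[i] by rewrite invr_gt0.
(* The bound holds at all indices; at the index [g] it contradicts the displacement of [x g] by
   [g]. *)
have := (bvalP y).2 _ h0; apply: (@filterS _ (nbhs (1%g : G))) => g /(_ g).
rewrite yx => gx; apply: contrapT => /eqP/xg gx1.
have := le_trans gx1 gx; rewrite invf_ge1// lern1.
by [].
Qed.

End CStarDisplacement.

(** * Null families, and multipliers forcing discreteness *)

Section NullFamilies.
Variables (R : realType) (I : choiceType) (A : I -> cstarAlgType R).

(* c_0(I, A) *)
Definition null_fam : set (forall i, A i) := [set x | bounded_fam x /\
  forall e : R[i], 0 < e -> exists D : seq I, forall i, i \notin D -> `|x i| <= e].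

Lemma null_fam_subalg : bounded_star_subalg null_fam.
Proof.
split.
- by move=> x [[k _ xk] _]; exists k.
- split; first exact: bounded_fam0.
  by move=> e e0; exists [::] => i _; rewrite normr0 ltW.
- move=> k x y [bx x0] [b_y y0]; split; first exact: bounded_fam_lin.
  move=> e e0; have k1 : 0 < `|k| + 1 by rewrite ltr_wpDl.
  have [D xD] := x0 _ (divr_gt0 e0 k1); have [D' yD] := y0 _ (divr_gt0 e0 k1).
  exists (D ++ D') => i; rewrite mem_cat negb_or => /andP[/xD xi /yD yi].
  rewrite (le_trans (ler_normD _ _))//.
  rewrite normrZ (le_trans (lerD (ler_wpM2l _ xi) yi))//.
  by rewrite -[X in _ + X]mul1r -mulrDl mulrCA mulfV ?mulr1// gt_eqF.
- move=> x y [bx x0] [[b b0 yb] y0]; split.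
    by apply: bounded_fam_mul => //; exists b.
  move=> e e0; have k1 : 0 < b + 1 by rewrite ltr_wpDl.
  have [D xD] := x0 _ (divr_gt0 e0 k1); exists D => i /xD xi.
  rewrite (le_trans (cnormM_le _ _))// (le_trans (ler_pM _ _ xi (yb i)))//.
  by rewrite mulrAC ler_pdivrMr// ler_wpM2l ?lerDl// ltW.
- move=> x [bx x0]; split; first exact: bounded_fam_star.
  by move=> e /x0[D xD]; exists D => i /xD; rewrite norm_cstar.
- move=> x xy; split.
    by apply: bounded_fam_closed => e e0; have [y [b_y _] ye] := xy e e0; exists y.
  move=> e e0; have e20 : 0 < e / 2 by rewrite divr_gt0.
  have [y [_ y0] ye] := xy _ e20; have [D yD] := y0 _ e20.
  exists D => i /yD yi; rewrite -(subrK (y i) (x i)) [e]splitr.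
  by rewrite (le_trans (ler_normD _ _))// lerD.
Qed.

(** Outside a finite [D], [x i] and its translates have norm at most [e / 2]; on [D], finitely many
    neighbourhoods of [1] are intersected. *)
Lemma null_fam_equicontinuous (G : topologicalGroupType)
    (act : forall i, G -> A i -> A i) x :
  (forall i, continuous_cstar_action (act i)) -> null_fam x ->
  orbit_equicontinuous (fun g (x : forall i, A i) i => act i g (x i)) x.
Proof.
move=> actP [_ x0] e e0.
have [D xD] := x0 _ (divr_gt0 e0 (ltr0Sn _ 1)).
have : \forall g \near (1%g : G), forall i, i \in D -> `|act i g (x i) - x i| <= e.
  elim: D {xD} => [|j D IH]; first exact: nearW.
  have [[act1 _] _ cact] := actP j.
  have /cvgrPdist_le/(_ e e0) := cact (x j) 1%g; rewrite act1.
  move=> jP; apply: (@filterS2 _ (nbhs (1%g : G)) _ _ _ _ _ jP IH) => g gj gD i.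
  rewrite inE => /predU1P[->|/gD//].
  by rewrite distrC.
apply: (@filterS _ (nbhs (1%g : G))) => g gD i.
have [/gD//|/xD xi] := boolP (i \in D).
rewrite (le_trans (ler_normB _ _))// [e]splitr lerD//.
by rewrite (le_trans (star_morphism_le (cstar_action_morphism (actP i) g) _)).
Qed.

Lemma null_fam_act (G : topologicalGroupType)
    (act : forall i, G -> A i -> A i) g x :
  (forall i, continuous_cstar_action (act i)) -> null_fam x ->
  null_fam (fun i => act i g (x i)).
Proof.
move=> actP [[k k0 xk] x0].
have actm i := cstar_action_morphism (actP i) g.
split; first by exists k => // i; rewrite (le_trans (star_morphism_le (actm i) _)).
move=> e /x0[D xD]; exists D => i /xD.
exact: le_trans (star_morphism_le (actm i) _).
Qed.

End NullFamilies.

Section MultiplierDisplacement.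
Variables (R : realType) (G : topologicalGroupType).
Hypotheses (hausG : hausdorff_space G) (lcG : locally_compact [set: G]).

(** Multiplication by the bounded family [x] is a multiplier [T] of c_0(G, A). Norm-continuity of
    its orbit under the lifted action controls all coordinates at once, and these are read off on
    the elements [delta g]. *)
Lemma multipliers_discrete :
  (forall (A : cstarAlgType R) (act : G -> A -> A),
     continuous_cstar_action act ->
     exists2 mact : G -> multiplier A -> multiplier A,
       continuous_cstar_action mact & equivariant act mact (@mult_of R A)) ->
  forall U : set G, open U.
Proof.
move=> lift; have [A [act [x [actP x1 xg]]]] := displacing_cstar_action R hausG lcG.
have fa := @pointwise_family_action R G G (fun=> A) (fun=> act)
  (fun=> cstar_action_action actP) (fun=> cstar_action_morphism actP).
pose hS := @null_fam_subalg R G (fun=> A).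
have S_act g y : @null_fam R G (fun=> A) y -> null_fam (fun i => act g (y i)).
  exact: (@null_fam_act R G (fun=> A) G (fun=> act)).
have S_equi y := @null_fam_equicontinuous R G (fun=> A) G (fun=> act) y (fun=> actP).
have actC := @bfam_act_continuous R G G _ _ fa _ hS S_act S_equi.
pose C : cstarAlgType R := bfam_alg hS; pose actc : G -> C -> C := bfam_act S_act.
have [mact mactP mactE] := lift C actc actC.
have mulS (y : C) : @null_fam R G (fun=> A) (fun i => cmul (x i) (bval y i)).
  case: y => y [[k k0 yk] y0]; split.
    by exists k => // i; rewrite (le_trans (cnormM_le _ _))// -[leRHS]mul1r ler_pM ?x1 ?yk.
  move=> e /y0[D yD]; exists D => i /yD yi.
  by rewrite (le_trans (cnormM_le _ _))// -[leRHS]mul1r ler_pM ?x1.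
have mulS' (y : C) : @null_fam R G (fun=> A) (fun i => cmul (bval y i) (x i)).
  case: y => y [[k k0 yk] y0]; split.
    by exists k => // i; rewrite (le_trans (cnormM_le _ _))// -[leRHS]mulr1 ler_pM ?x1 ?yk.
  move=> e /y0[D yD]; exists D => i /yD yi.
  by rewrite (le_trans (cnormM_le _ _))// -[leRHS]mulr1 ler_pM ?x1.
pose TL (y : C) : C := BFam (mulS y); pose TR (y : C) : C := BFam (mulS' y).
have Tdc : (TL, TR) \in @is_double_centralizer R C.
  apply/asboolP; split => /=.
  - by move=> k y z; apply: bfam_eq => i; rewrite /= cmulDr cmulZr.
  - by move=> k y z; apply: bfam_eq => i; rewrite /= cmulDl cmulZl.
  - exists 1 => y; rewrite mul1r; apply: bfam_norm_le => // i /=.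
    rewrite (le_trans (cnormM_le _ _))// -[leRHS]mul1r ler_pM ?x1//.
    exact: bfam_norm_i.
  - exists 1 => y; rewrite mul1r; apply: bfam_norm_le => // i /=.
    rewrite (le_trans (cnormM_le _ _))// -[leRHS]mulr1 ler_pM ?x1//.
    exact: bfam_norm_i.
  - by move=> y z; apply: bfam_eq => i; exact: cmulA.
  - by move=> y z; apply: bfam_eq => i; rewrite /= cmulA.
  - by move=> y z; apply: bfam_eq => i; exact: cmulA.
pose T : multiplier C := Multiplier Tdc.
have deltaS j : @null_fam R G (fun=> A) (fun i => if i == j then cone else 0).
  split.
    exists 1 => // i; case: ifP => _; first exact: norm_cone_le.
    by rewrite normr0.
  by move=> e e0; exists [:: j] => i; rewrite inE => /negbTE ->; rewrite normr0 ltW.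
(* The unit of the [j]-th copy of [A]: it is fixed by the action and isolates the [j]-th
   coordinate. *)
pose delta j : C := BFam (deltaS j).
have delta1 j : `|delta j| <= 1.
  apply: bfam_norm_le => // i /=; case: ifP => _; first exact: norm_cone_le.
  by rewrite normr0.
have act_delta g j : actc g (delta j) = delta j.
  apply: bfam_eq => i /=; case: ifP => _; first exact: cstar_action_cone.
  by have [-> _ _ _] := star_morphism_raddf (cstar_action_morphism actP g).
(* The lift [mact] is prescribed only on the image of [mult_of]. That image contains the product of
   [T] with [mult_of y], so multiplicativity of [mact g] determines [mact g T] on translates. *)
have mactT g (y : C) : (mval (mact g T)).1 (actc g y) = actc g (TL y).
  apply: (@mult_of_inj R C); rewrite mactE.
  have -> : mult_of (TL y) = cmul T (mult_of y).
    apply: mult_eq => z; apply: bfam_eq => i /=.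
    by rewrite cmulA.
  have [_ mM _] := cstar_action_morphism mactP g.
  rewrite mM -mactE; apply: mult_eq => z.
  by have [_ _ _ _ mL _ _] := multP (mact g T); rewrite /= mL.
apply: discrete_group.
have h0 : 0 < 2^-1 :> R[i] by rewrite invr_gt0.
have [[m1 _] _ cm] := mactP.
have /cvgrPdist_le/(_ _ h0) := cm T 1%g; rewrite m1.
apply: (@filterS _ (nbhs (1%g : G))) => g; rewrite distrC => gT.
apply: contrapT => /eqP/xg gx1.
have : `|act g (x g) - x g| <= 2^-1.
  apply: le_trans gT; rewrite mult_normE.
  have := mult_norm_ub (mact g T - T) (delta g).
  rewrite [X in `|X|](_ : _ = (mval (mact g T)).1 (delta g) - (mval T).1 (delta g))//.
  rewrite -{1}(act_delta g g) mactT => /= dT.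
  have := le_trans (bfam_norm_i (actc g (TL (delta g)) - TL (delta g)) g)
    (le_trans dT (ler_piMr (mult_norm_ge0 _) (delta1 g))).
  by rewrite /= eqxx !cmul1r.
move=> /(le_trans gx1); rewrite invf_ge1// lern1.
by [].
Qed.

End MultiplierDisplacement.

Theorem theorem3p1 (R : realType) (G : topologicalGroupType)
    (hausG : hausdorff_space G) (lcG : locally_compact [set: G]) :
  [<-> forall U : set G, open U ;
       forall (X bX : topologicalType) (i : X -> bX) (act : G -> X -> X),
         stone_cech i -> continuous_action act ->
         exists2 bact : G -> bX -> bX,
           continuous_action bact & equivariant act bact i ;
       forall (A : cstarAlgType R) (act : G -> A -> A),
         continuous_cstar_action act ->
         exists2 mact : G -> multiplier A -> multiplier A,
           continuous_cstar_action mact & equivariant act mact (@mult_of R A) ;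
       preserves_products (forget_ucstar R G) ;
       preserves_coproducts (forget_compHaus G)].

Proof.
(* Each of (b), (c), (d) is first shown to give discreteness, from which the next condition follows;
   (e) closes the cycle. *)
tfae.
- move=> oG X bX i act sc actX; exact: discrete_stone_cech oG sc actX.
- move=> /(stone_cech_discrete R hausG lcG) oG A act actP.
  exists (mult_act actP); last exact: mult_act_equivariant.
  exact: mult_act_continuous.
- by move=> /(multipliers_discrete hausG lcG) oG; exact: discrete_preserves_products.
- by move=> /(products_discrete hausG lcG) oG; exact: discrete_preserves_coproducts.
- exact: (coproducts_discrete R hausG lcG).
Qed.
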